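(* Let $\kappa$ be a regular uncountable cardinal, $\lambda<\kappa$ an infinite cardinal, $\theta$ a cardinal, and $T\subseteq\kappa$ a stationary set of limit ordinals. For each $\delta\in E^\kappa_\lambda$ let $J_\delta$ be a $\lambda$-complete proper ideal over $\delta$ extending $J^{\mathrm{bd}}[\delta]$. Suppose $\vec C=\langle C_\delta\mid\delta\in E^\kappa_\lambda\rangle$ is a $\lambda$-bounded $C$-sequence such that for every club $D\subseteq\kappa$ there exists $\delta\in E^\kappa_\lambda$ with $$\{\beta<\delta\mid \min(C_\delta\setminus(\beta+1))\in D\cap T\}\in J_\delta^+.$$ Assume any one of the following: (1) $\theta=\lambda$ and $\diamondsuit^*(\lambda)$ holds; (2) $\lambda$ is not strongly inaccessible, and $\theta$ is the least cardinal such that $2^\theta\ge\lambda$; (3) $\theta^+=\lambda$; (4) $\theta=\omega$ and $\lambda$ is not ineffable. Then there exists a sequence of maps $\langle h_\delta:\lambda\to\theta\mid\delta\in E^\kappa_\lambda\rangle$ such that for every club $D\subseteq\kappa$ there exists $\delta\in E^\kappa_\lambda$ such that for every $\tau<\theta$, $$\{\beta<\delta\mid h_\delta(\mathrm{otp}(C_\delta\cap\beta))=\tau\ \&\ \min(C_\delta\setminus(\beta+1))\in D\cap T\}\in J_\delta^+.$$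
   Context: $E^\kappa_\lambda=\{\alpha<\kappa\mid\mathrm{cf}(\alpha)=\lambda\}$. A $C$-sequence over $S$ is $\langle C_\delta\mid\delta\in S\rangle$ with each $C_\delta$ a closed subset of $\delta$ with $\sup(C_\delta)=\delta$; it is $\lambda$-bounded if $\mathrm{otp}(C_\delta)\le\lambda$ for all $\delta$. $J^{\mathrm{bd}}[\delta]$ is the ideal of bounded subsets of $\delta$, and $J^+=\mathcal P(\delta)\setminus J$. $\diamondsuit^*(\lambda)$ is Jensen's diamond-star principle.
   Formalization: In (2) and (4), λ is additionally assumed uncountable; for λ=θ=ω the claim is false (κ=ω_2, T the limit ordinals, C a club-guessing sequence of order type ω, each J_δ a maximal ideal extending J^bd[δ]). *)

(* Defs.v *)
From mathcomp Require Import all_boot all_order.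
From mathcomp Require Import boolp classical_sets functions cardinality wochoice.

Set Implicit Arguments.
Unset Strict Implicit.
Unset Printing Implicit Defensive.
Import Order.TTheory.
Local Open Scope order_scope.
Local Open Scope card_scope.
Local Open Scope classical_set_scope.

(* An ordinal kappa is represented by a well-ordered type K, with least element
   \bot, so that the inhabitants of K are the ordinals below kappa.  An ordinal
   a < kappa, seen as the set of its predecessors, is the initial segment
   [seg a]; kappa itself is [[set: K]].  Notions that are needed both for kappa
   and for ordinals below it take as argument an initial segment I : set K. *)
Section Ordinals.
Context {d : Order.disp_t} {K : bOrderType d}.
Implicit Types (a b lam theta mu delta : K) (I A B C D S T : set K).

Definition seg a : set K := [set b | b < a].

Definition card_lt (U V : Type) (A : set U) (B : set V) : Prop :=
  ~ (B #<= A).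

Definition cardinal I : Prop := forall a, I a -> card_lt (seg a) I.

Definition infinite_cardinal I : Prop := cardinal I /\ infinite_set I.

Definition is_omega theta : Prop :=
  infinite_set (seg theta) /\ forall n, n < theta -> finite_set (seg n).

(* theta^+ = lam *)
Definition is_succ_cardinal theta lam : Prop :=
  [/\ cardinal (seg lam), theta < lam &
      forall mu, cardinal (seg mu) -> theta < mu -> lam <= mu].

(* |P(mu)| *)
Definition pow mu : set (set K) := [set A | A `<=` seg mu].

Definition limit a : Prop :=
  a != \bot /\ forall b, b < a -> exists2 c, b < c & c < a.

(* The value \bot in degenerate cases (A empty, respectively A of order type
   at least kappa) is never used. *)
Definition omin A : K := xget \bot (A `&` lbound A).

Definition order_iso A B : Prop :=
  exists f : K -> K, set_bij A B f /\
    {in A &, forall x y, (f x < f y) = (x < y)}.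

Definition otp A : K := xget \bot [set mu | order_iso (seg mu) A].

Definition cofinal I A : Prop :=
  A `<=` I /\ forall x, I x -> exists2 a, A a & x <= a.

(* cf(I) = mu *)
Definition is_cf I mu : Prop :=
  [/\ cardinal (seg mu),
      exists2 A, cofinal I A & A #= seg mu &
      forall A, cofinal I A -> seg mu #<= A].

(* cf(I) = I; the cofinality of kappa need not be below kappa, so this is
   phrased without [is_cf]. *)
Definition regular I : Prop :=
  infinite_cardinal I /\ forall A, cofinal I A -> I #<= A.

Definition regular_uncountable I : Prop := regular I /\ ~ countable I.

(* E^kappa_lam *)
Definition Ecf lam : set K := [set delta | is_cf (seg delta) lam].

Definition closed_in I C : Prop :=
  C `<=` I /\
  forall a, I a -> C `&` seg a !=set0 -> supremums (C `&` seg a) a -> C a.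

Definition club I C : Prop := closed_in I C /\ cofinal I C.

Definition stationary I S : Prop :=
  S `<=` I /\ forall D, club I D -> S `&` D !=set0.

Definition C_sequence S (C : K -> set K) : Prop :=
  forall delta, S delta ->
    closed_in (seg delta) (C delta) /\ supremums (C delta) delta.

Definition bounded_C_sequence lam S (C : K -> set K) : Prop :=
  C_sequence S C /\ forall delta, S delta -> otp (C delta) <= lam.

Definition proper_ideal delta (J : set (set K)) : Prop :=
  [/\ J `<=` [set A | A `<=` seg delta],
      J set0,
      forall A B, A `<=` B -> J B -> J A,
      forall A B, J A -> J B -> J (A `|` B) &
      ~ J (seg delta)].

(* Jbd[delta] *)
Definition Jbd delta : set (set K) :=
  [set A | A `<=` seg delta /\ exists2 g, g < delta & A `<=` seg g].

Definition complete_ideal lam (J : set (set K)) : Prop :=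
  forall F : set (set K), F `<=` J -> card_lt F (seg lam) ->
    J (\bigcup_(A in F) A).

(* J^+, for J an ideal over delta *)
Definition positive delta (J : set (set K)) : set (set K) :=
  [set A | A `<=` seg delta /\ ~ J A].

(* omega is neither strongly inaccessible nor ineffable in the senses below.
   Where the negation of one of these properties is meant as an assumption on
   uncountable cardinals, uncountability has to be assumed separately. *)
Definition strongly_inaccessible lam : Prop :=
  regular_uncountable (seg lam) /\
  forall mu, mu < lam -> card_lt (pow mu) (seg lam).

Definition ineffable lam : Prop :=
  regular_uncountable (seg lam) /\
  forall A : K -> set K, (forall a, a < lam -> A a `<=` seg a) ->
    exists2 B, B `<=` seg lam &
      stationary (seg lam) [set a | a < lam /\ B `&` seg a = A a].

Definition diamond_star lam : Prop :=
  exists AA : K -> set (set K),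
    (forall a, a < lam -> AA a `<=` pow a /\ AA a #<= seg a) /\
    forall Z, Z `<=` seg lam ->
      exists2 D, club (seg lam) D & forall a, D a -> AA a (Z `&` seg a).

End Ordinals.

(* Main.v *)
From HB Require Import structures.
Require Import Defs.
From mathcomp Require Import all_boot all_order finmap.
From mathcomp Require Import boolp classical_sets functions cardinality wochoice.
Import Order.TTheory.
Local Open Scope order_scope.
Local Open Scope card_scope.
Local Open Scope classical_set_scope.

(** The map k_delta : beta |-> otp (C_delta `&` beta) has bounded, hence J_delta-null,
    fibres, so lambda-completeness makes lambda regular.  Suppose that every h is
    refuted by some club D: for all delta, h_delta o k_delta misses a color modulo
    J_delta on the set B_delta(D) of the points that guess D.  As at most lambda
    many clubs have a common subclub, lambda many colorings can be refuted at once.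

    If theta < lambda, fix lambda many colorings of lambda by fewer than lambda
    colors.  Compose each with a surjection onto theta, chosen in terms of D, from the
    set of its colors that are positive on B_delta(D): a refutation loses one of these
    colors.  Along lambda many decreasing clubs this cannot go on, so there is a D
    such that no coloring has theta many positive colors on any B_delta(D).
    In (2) this contradicts the colorings by the splitting levels Delta(a_i, .) of
    distinct a_i in 2^theta, in (3) the colorings read off from an Ulam matrix.

    In (1) and (4), where lambda is uncountable, the colorings are evaluated at f(k beta)
    for some f with null fibres.  Diamond-star, resp. a witness against ineffability,
    turns refuted colorings into a function g < f with null fibres, almost everywhere
    on B_delta(D); iterating this omega times gives decreasing sequences of ordinals.
    For (4), the thinning above yields omega colors out of two when lambda is
    inaccessible, and otherwise the argument for (2) applies. *)

Set Implicit Arguments.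
Unset Strict Implicit.
Unset Printing Implicit Defensive.

(** * Well-orders, ranks and cardinals *)

(** [F x] may consult its argument only below x, so the filler [v0] handed to it elsewhere is
    invisible. *)
Lemma wf_fix (U V : Type) (R : U -> U -> Prop) (F : U -> (U -> V) -> V) (v0 : V) :
  well_founded R ->
  (forall x g h, (forall y, R y x -> g y = h y) -> F x g = F x h) ->
  exists r : U -> V, forall x, r x = F x r.
Proof.
move=> wfR Fext.
pose G x (rec : forall y, R y x -> V) : V :=
  F x (fun y => if pselect (R y x) is left p then rec y p else v0).
exists (Fix wfR (fun=> V) G) => x.
rewrite Fix_eq; last first.
  by move=> y f g fg; apply: Fext => z Rzy; case: pselect.
by apply: Fext => y Ryx; case: pselect.
Qed.

Lemma card_leE (U : Type) (V : choiceType) (v0 : V) (A : set U) (B : set V) :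
  (A #<= B) <-> exists f : U -> V, (forall x, A x -> B (f x)) /\
    forall x y, A x -> A y -> f x = f y -> x = y.
Proof.
pose W : pointedType := HB.pack V (isPointed.Build V v0).
split=> [/(@pcard_leP _ W)/injfunPex[f fAB finj]|[f [fAB finj]]].
  exists f; split=> // x y Ax Ay; apply: finj; exact: mem_set.
apply/(@pcard_leP _ W)/injfunPex; exists f => // x y /set_mem Ax /set_mem Ay.
exact: finj.
Qed.

(** Each point of A in turn takes a value of B not yet taken by a predecessor in A; if this gets
    stuck at x, the predecessors have used up all of B. Both comparability of cardinals and the
    square of a cardinal come from this. *)
Lemma greedy (U : Type) (V : choiceType) (v0 : V) (R : U -> U -> Prop) (A : set U) (B : set V) :
  well_founded R -> (forall x y, [\/ R x y, x = y | R y x]) ->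
  (A #<= B) \/ exists2 x, A x & (B #<= A `&` [set y | R y x]).
Proof.
move=> wfR tri.
have [|g gE] := @wf_fix U V R (fun x g => xget v0 (B `\` g @` (A `&` [set y | R y x]))) v0 wfR.
  move=> x g h gh; congr (xget _ (_ `\` _)); apply/seteqP; split=> z [y [Ay Ry]] <-;
  by exists y => //; rewrite gh.
have [[x [Ax Bx]]|nex] := EM (exists x, A x /\ B `<=` g @` (A `&` [set y | R y x])).
  right; exists x => //; apply: card_le_trans (card_image_le g _).
  exact: subset_card_le Bx.
left; apply/(card_leE v0); exists g.
have gP x : A x -> (B `\` g @` (A `&` [set y | R y x])) (g x).
  move=> Ax; rewrite gE; apply: xgetPex; apply: contrapT => nx.
  apply: nex; exists x; split=> // z Bz; apply: contrapT => nz.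
  by apply: nx; exists z.
split=> [x /gP[]//|x y Ax Ay gxy].
case: (tri x y) => // Rxy; exfalso.
  by have [_] := gP y Ay; apply; exists x.
by have [_] := gP x Ax; apply; exists y.
Qed.

Section WellOrder.
Context {d : Order.disp_t} {K : bOrderType d}.
Hypothesis K_wo : well_order (<=%O : rel K).
Implicit Types (a b x y z mu : K) (A B : set K).

Lemma wo_min A : A !=set0 -> exists2 m, A m & forall x, A x -> m <= x.
Proof.
move=> [x Ax]; have [|m [[Am mlb] _]] := @K_wo (fun x => `[< A x >]).
  by exists x; apply/asboolP.
exists m; first exact/asboolP.
by move=> y Ay; apply: mlb; apply/asboolP.
Qed.

Lemma lt_wf : well_founded (fun x y => x < y).
Proof.
move=> x; apply: contrapT => nx.
have [m nm mle] := @wo_min [set y | ~ Acc (fun x y => x < y) y] (ex_intro _ x nx).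
apply: nm; constructor=> y ym; apply: contrapT => /mle.
by rewrite leNgt ym.
Qed.

Lemma lt_ind (P : K -> Prop) : (forall x, (forall y, y < x -> P y) -> P x) -> forall x, P x.
Proof. by move=> IH x; apply: (well_founded_ind lt_wf). Qed.

Lemma lt_tri x y : [\/ x < y, x = y | y < x].
Proof. by case: (ltgtP x y); [constructor 1|constructor 3|constructor 2]. Qed.

Lemma card_total (V : choiceType) (v0 : V) A (B : set V) : (A #<= B) \/ (B #<= A).
Proof.
case: (greedy v0 A B lt_wf lt_tri) => [|[x _ le]]; [by left|right].
by apply: card_le_trans le _; apply: subset_card_le => y [].
Qed.

Lemma card_leK (U : Type) (A : set U) B :
  (A #<= B) <-> exists f : U -> K, (forall u, A u -> B (f u)) /\
    forall u v, A u -> A v -> f u = f v -> u = v.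
Proof. exact: card_leE \bot _ _. Qed.

Lemma card_le_seg x y : x <= y -> seg x #<= seg y.
Proof. by move=> xy; apply: subset_card_le => z /= zx; apply: lt_le_trans zx xy. Qed.

Lemma exists_cardinal x : exists mu, [/\ cardinal (seg mu), mu <= x & seg x #<= seg mu].
Proof.
have [|m xm mle] := @wo_min [set m | seg x #<= seg m]; first by exists x; exact: card_lexx.
exists m; split=> // [a am le|]; last exact: mle (card_lexx _).
by have := mle a (card_le_trans xm le); rewrite leNgt am.
Qed.

End WellOrder.

(** * Order types of initial parts as ranks *)

Section Rank.
Context {d : Order.disp_t} {K : bOrderType d}.
Hypothesis K_wo : well_order (<=%O : rel K).
Implicit Types (a b m x y z mu : K) (A B : set K).

Lemma rank_ex A : exists r : K -> K,
  [/\ forall x y, A x -> x < y -> r x < r y,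
      forall x u, u < r x -> exists y, [/\ A y, y < x & r y = u] &
      forall x, r x <= x].
Proof.
pose I g x : set K := g @` (A `&` seg x).
(* The least value not taken below x by an element of A: the collapse of A. *)
have [|r rE] := @wf_fix _ _ _ (fun x g => xget \bot (~` I g x `&` lbound (~` I g x))) \bot (lt_wf K_wo).
  move=> x g h gh; suff -> : I g x = I h x by [].
  by apply/seteqP; split=> z [y [Ay yx]] <-; exists y => //; rewrite gh.
have rP x : (~` I r x `&` lbound (~` I r x)) (r x) /\ r x <= x.
  elim/(lt_ind K_wo): x => x IH.
  have nx : (~` I r x) x by move=> [y [_ yx]] rx; have [_] := IH y yx; rewrite rx leNgt yx.
  have [m nm mle] := wo_min K_wo (ex_intro _ x nx).
  have rx : (~` I r x `&` lbound (~` I r x)) (r x).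
    by rewrite rE; apply: xgetPex; exists m; split.
  by split=> //; have [_] := rx; apply.
have rlt x u : u < r x -> exists y, [/\ A y, y < x & r y = u].
  move=> ux; have [[_ lb] _] := rP x; apply: contrapT => nex.
  have /lb : (~` I r x) u by move=> [y [Ay yx] ryu]; apply: nex; exists y.
  by rewrite leNgt ux.
exists r; split=> // [x y Ax xy|x]; last by have [] := rP x.
have [[nI _] _] := rP y; rewrite ltNge; apply/negP; rewrite le_eqVlt.
move=> /orP[/eqP ryx|/rlt[z [Az zx rzy]]]; apply: nI.
  by exists x.
by exists z => //; split=> //; apply: lt_trans zx xy.
Qed.

Lemma incr_ge mu (f : K -> K) :
  (forall x y, x < y -> y < mu -> f x < f y) -> forall x, x < mu -> x <= f x.
Proof.
move=> fi; elim/(lt_ind K_wo) => x IH xmu; rewrite leNgt; apply/negP => fx.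
have := IH _ fx (lt_trans fx xmu); rewrite leNgt => /negP; apply.
exact: fi.
Qed.

(** One isomorphism followed by the inverse of the other is strictly increasing from a into b, and
    such a map never moves a point down. *)
Lemma order_iso_le a b A : order_iso (seg a) A -> order_iso (seg b) A -> a <= b.
Proof.
move=> [f [[fA fi fs] fo]] [g [[gA gi gs] go]].
rewrite leNgt; apply/negP => ba.
have hP x : exists y, x < a -> y < b /\ g y = f x.
  have [xa|nx] := pselect (x < a); last by exists x.
  by have /gs[y yb gy] := fA x xa; exists y.
have {hP}[h hP] := choice hP.
have hi : forall x y, x < y -> y < a -> h x < h y.
  move=> x y xy ya; have xa := lt_trans xy ya.
  have [[hx gx] [hy gy]] := (hP x xa, hP y ya).
  by rewrite -go ?inE// gx gy fo ?inE.
have := incr_ge hi ba; rewrite leNgt; have [-> //] := hP b ba.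
Qed.

Definition rk A x := otp (A `&` seg x).

Lemma rkP A :
  [/\ forall x y, A x -> x < y -> rk A x < rk A y,
      forall x u, u < rk A x -> exists y, [/\ A y, y < x & rk A y = u] &
      forall x, rk A x <= x].
Proof.
have [r [ri rl rx]] := rank_ex A.
suff rkE : rk A = r by rewrite rkE.
have riE x y : A x -> A y -> (r x < r y) = (x < y).
  move=> Ax Ay; case: (ltgtP x y) => [/ri->//|/ri lt|->]; last by rewrite ltxx.
  by apply/negbTE; rewrite -leNgt ltW// lt.
apply/funext => x.
have iso : order_iso (seg (r x)) (A `&` seg x).
  have fP u : exists y, u < r x -> [/\ A y, y < x & r y = u].
    by have [/rl[y yP]|//] := pselect (u < r x); [exists y|exists u].
  have [f {}fP] := choice fP; exists f; split; last first.
    move=> u v; rewrite !inE => /fP[Au ux ru] /fP[Av vx rv].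
    by rewrite -riE// ru rv.
  split=> [u /fP[]//|u v|y [Ay yx]].
    by rewrite !inE => /fP[_ _ eu] /fP[_ _ ev] e; rewrite -eu -ev e.
  have rxy := ri _ _ Ay yx; exists (r y) => //.
  have [Af fx rf] := fP _ rxy.
  by case: (lt_tri (f (r y)) y) => // lt; have := lt; rewrite -riE// rf ltxx.
apply: xget_subset1 => // a b /= ia ib.
by apply/le_anti; rewrite (order_iso_le ia ib) (order_iso_le ib ia).
Qed.

Lemma rk_lt A x y : A x -> x < y -> rk A x < rk A y.
Proof. by have [+ _ _] := rkP A; apply. Qed.

Lemma rk_surj A x u : u < rk A x -> exists y, [/\ A y, y < x & rk A y = u].
Proof. by have [_ + _] := rkP A; apply. Qed.

Lemma rk_inj A x y : A x -> A y -> rk A x = rk A y -> x = y.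
Proof.
move=> Ax Ay e; case: (lt_tri x y) => // lt; exfalso.
  by have := rk_lt Ax lt; rewrite e ltxx.
by have := rk_lt Ay lt; rewrite e ltxx.
Qed.

Lemma rk_le A x y : x <= y -> rk A x <= rk A y.
Proof.
move=> xy; rewrite leNgt; apply/negP => /rk_surj[z [Az zx e]].
by have := rk_lt Az (lt_le_trans zx xy); rewrite e ltxx.
Qed.

(** Ranks leave no gaps: if no g below theta bounded them, every ordinal below theta would be a
    rank, and choosing elements of these ranks would inject theta into A. *)
Lemma rk_bounded A theta : ~ (seg theta #<= A) ->
  exists2 g, g < theta & forall x, A x -> rk A x < g.
Proof.
move=> nle; apply: contrapT => nex; apply: nle.
have fP u : exists y, u < theta -> A y /\ rk A y = u.
  have [ut|nu] := pselect (u < theta); last by exists u.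
  have [x nx] : exists x, ~ (A x -> rk A x < u).
    by apply/existsNP => all; apply: nex; exists u.
  have [Ax /negP] : A x /\ ~ (rk A x < u) by apply/not_implyP.
  rewrite -leNgt le_eqVlt => /orP[/eqP ->|/rk_surj[y [Ay _ yu]]].
    by exists x.
  by exists y.
have [f {}fP] := choice fP; apply/card_leK; exists f; split=> [u /fP[]//|u v].
by move=> /fP[_ eu] /fP[_ ev] e; rewrite -eu -ev e.
Qed.

End Rank.

(** * Squares of infinite cardinals *)

Section Pairing.
Context {d : Order.disp_t} {K : bOrderType d}.
Hypothesis K_wo : well_order (<=%O : rel K).
Implicit Types (a b m x y z mu : K) (A B : set K).

Lemma infinite_segS m : infinite_set (seg m) -> [set x | x <= m] #<= seg m.
Proof.
move=> /infiniteP/card_leK[i [im ii]].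
apply/card_leK.
(* Hilbert's hotel: m moves to [i 0], each [i n] to [i n.+1], all other points stay. *)
have [|f fP] := @choice _ _ (fun x y => [/\ x = m -> y = i 0%N,
   x != m -> (forall n, x = i n -> y = i n.+1) &
   x != m -> (forall n, x != i n) -> y = x]).
  move=> x; have [->|xm] := eqVneq x m; first by exists (i 0%N); split.
  have [[n ->]|nx] := pselect (exists n, x = i n).
    exists (i n.+1); split=> [||_ /(_ n)]; last by rewrite eqxx.
      by move=> e; have := im n I; rewrite /seg /= -e ltxx.
    by move=> _ k /ii ->.
  exists x; split=> // [e|_ n e]; first by rewrite e eqxx in xm.
  by case: nx; exists n.
have fE x : x <= m -> [\/ x = m /\ f x = i 0%N,
    exists2 n, x = i n & f x = i n.+1 | [/\ x < m, f x = x & forall n, x != i n]].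
  move=> xm; have [f1 f2 f3] := fP x.
  have [e|ne] := eqVneq x m; first by constructor 1; rewrite f1.
  have [[n e]|nx] := pselect (exists n, x = i n).
    by constructor 2; exists n => //; apply: f2.
  have nx' n : x != i n by apply/eqP => e; apply: nx; exists n.
  by constructor 3; split=> //; [rewrite lt_neqAle ne|apply: f3].
exists f; split=> [x /= /fE[[_ ->]|[n _ ->]|[xm -> //]]|x y /= /fE fx /fE fy].
- exact: im.
- exact: im.
case: fx => [[-> ->]|[n -> ->]|[xm -> nx]]; case: fy => [[-> ->]|[k -> ->]|[ym -> ny]] //.
- by move=> /ii-/(_ I I).
- by move=> e; have := ny 0%N; rewrite e eqxx.
- by move=> /ii-/(_ I I).
- by move=> /ii-/(_ I I)[->].
- by move=> e; have := ny n.+1; rewrite e eqxx.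
- by move=> e; have := nx 0%N; rewrite e eqxx.
- by move=> e; have := nx k.+1; rewrite e eqxx.
Qed.

Lemma infinite_cardinal_limit a m :
  infinite_cardinal (seg a) -> m < a -> exists2 n, m < n & n < a.
Proof.
move=> [ca ia] ma; apply: contrapT => nex.
have sub : seg a `<=` [set x | x <= m].
  by move=> x xa; rewrite /= leNgt; apply/negP => mx; apply: nex; exists x.
have [fm|im] := pselect (finite_set (seg m)).
  apply: ia; apply: (@sub_finite_set _ _ (seg m `|` [set m])).
    by move=> x /sub; rewrite /= le_eqVlt => /orP[/eqP|]; [right|left].
  by rewrite finite_setU; split=> //; exact: finite_set1.
apply: (ca _ ma); apply: card_le_trans (subset_card_le sub) (infinite_segS im).
Qed.

(* By maximum, then lexicographically: the predecessors of (x, y) lie in the square of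
   a smaller ordinal, so that [greedy] applies. *)
Let godel (u v : K * K) : Prop :=
  Order.max u.1 u.2 < Order.max v.1 v.2 \/
  Order.max u.1 u.2 = Order.max v.1 v.2 /\ (u.1 < v.1 \/ u.1 = v.1 /\ u.2 < v.2).

Let godel_wf : well_founded godel.
Proof.
suff H : forall m x y, forall u, Order.max u.1 u.2 = m -> u.1 = x -> u.2 = y -> Acc godel u.
  by move=> u; apply: H.
elim/(lt_ind K_wo) => m IHm; elim/(lt_ind K_wo) => x IHx; elim/(lt_ind K_wo) => y IHy.
move=> u um ux uy; constructor => v [vu|[vu [v1|[v1 v2]]]].
- by apply: IHm; rewrite -?um //; exact: vu.
- by apply: IHx; rewrite -?ux//; [exact: v1|rewrite vu um].
- by apply: IHy; rewrite -?uy//; [exact: v2|rewrite vu um|rewrite v1 ux].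
Qed.

Let godel_tri u v : [\/ godel u v, u = v | godel v u].
Proof.
case: (lt_tri (Order.max u.1 u.2) (Order.max v.1 v.2)) => [lt|e|lt].
- by constructor 1; left.
- case: (lt_tri u.1 v.1) => [lt|e1|lt].
  + by constructor 1; right; split=> //; left.
  + case: (lt_tri u.2 v.2) => [lt|e2|lt].
    * by constructor 1; right; split=> //; right.
    * by constructor 2; case: u v e1 e2 {e} => [? ?] [? ?] /= -> ->.
    * by constructor 3; right; split=> //; right.
  + by constructor 3; right; split=> //; left.
- by constructor 3; left.
Qed.

Lemma card_square a : infinite_set (seg a) -> seg a `*` seg a #<= seg a.
Proof.
elim/(lt_ind K_wo): a => a IH ia.
have [mu [cmu mua amu]] := exists_cardinal K_wo a.
move: mua; rewrite le_eqVlt => /orP[/eqP e|lt].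
  rewrite {mu amu}e in cmu.
  (* If no injection arises, the predecessors of some pair are as many as a; they lie in the square
     of some m below a, which is finite or, by induction, no larger than m. *)
  case: (greedy \bot (seg a `*` seg a) (seg a) godel_wf godel_tri) => // -[u [u1 u2] le].
  exfalso; have ma : Order.max u.1 u.2 < a by rewrite gt_max u1 u2.
  have [m um ma'] := infinite_cardinal_limit (conj cmu ia) ma.
  have {}le : seg a #<= seg m `*` seg m.
    apply: card_le_trans le _; apply: subset_card_le => v [_ vu].
    have vm : Order.max v.1 v.2 < m by case: vu => [vu|[-> _]] //; apply: lt_trans vu um.
    by move: vm; rewrite gt_max => /andP[].
  have [fm|im] := pselect (finite_set (seg m)).
    by apply: ia; apply: card_le_finite le _; apply: finite_setX.
  by apply: (cmu _ ma'); apply: card_le_trans le (IH _ ma' im).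
have imu : infinite_set (seg mu) by move=> f; apply: ia; apply: card_le_finite amu f.
apply: card_le_trans (card_le_trans (IH _ lt imu) (card_le_seg (ltW lt))).
have /card_leK[f [fmu fi]] := amu.
apply/(card_leE (\bot, \bot)); exists (fun u => (f u.1, f u.2)); split.
  by move=> u [u1 u2]; split; exact: fmu.
move=> [u1 u2] [v1 v2] [/= a1 a2] [/= b1 b2] [e1 e2].
by rewrite (fi _ _ a1 b1 e1) (fi _ _ a2 b2 e2).
Qed.

Lemma pairing a : infinite_set (seg a) -> exists p : K -> K -> K,
  (forall x y, x < a -> y < a -> p x y < a) /\
  forall x y x' y', x < a -> y < a -> x' < a -> y' < a ->
    p x y = p x' y' -> x = x' /\ y = y'.
Proof.
move=> /card_square/card_leK[f [fa fi]]; exists (fun x y => f (x, y)); split.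
  by move=> x y xa ya; apply: fa.
move=> x y x' y' xa ya xa' ya' e.
by have [-> ->] := fi (x, y) (x', y') (conj xa ya) (conj xa' ya') e.
Qed.

End Pairing.

(** * Clubs and ideals *)

Section Clubs.
Context {d : Order.disp_t} {K : bOrderType d}.
Hypothesis K_wo : well_order (<=%O : rel K).
Hypothesis K_reg : regular_uncountable [set: K].
Implicit Types (a b m x y z mu : K) (A B : set K).

Lemma regular_bound A : ~ ([set: K] #<= A) -> exists b, forall a, A a -> a < b.
Proof.
move=> nle; apply: contrapT => nex; apply: nle; apply: K_reg.1.2; split=> // x _.
apply: contrapT => nx; apply: nex; exists x => a Aa; rewrite ltNge.
by apply/negP => xa; apply: nx; exists a.
Qed.

Lemma uncountable_bound A : countable A -> exists b, forall a, A a -> a < b.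
Proof.
by move=> cA; apply: regular_bound => le; apply: K_reg.2; apply: card_le_trans le cA.
Qed.

Lemma club_bigcap (X : Type) (S : set X) (lam : K) (G : X -> set K) :
  S #<= seg lam -> (forall i, S i -> club [set: K] (G i)) ->
  club [set: K] (\bigcap_(i in S) G i).
Proof.
move=> Sle Gclub.
have club_sup a D i : S i -> D `<=` G i -> G i `&` seg a !=set0 ->
    supremums (D `&` seg a) a -> G i a.
  move=> Si DG ne [ub lub]; have [[_ cl] _] := Gclub i Si; apply: cl => //.
  split=> [z []/= _ /ltW//|b bub]; apply: lub => z [Dz za].
  by apply: bub; split=> //; exact: DG.
split.
  split=> // a _ [x [Gx xa]] sup i Si; apply: (club_sup a (\bigcap_(i in S) G i)) => // [z /(_ i Si)//|].
  by exists x; split=> //; exact: Gx.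
split=> // x _.
(* Every [G i] has a point between y and z. The supremum of omega many such steps is a limit of
   points of each [G i]. *)
have nextP y : exists z, y < z /\ forall i, S i -> exists2 g, G i g & y < g /\ g <= z.
  have [y' yy'] : exists y', y < y'.
    have [b bP] := uncountable_bound (countable1 y); exists b; exact: bP.
  have [|g gP] := @choice _ _ (fun i z => S i -> G i z /\ y < z).
    move=> i; have [Si|?] := pselect (S i); last by exists y.
    have [_ [_ cof]] := Gclub i Si; have [z Gz yz] := cof y' I.
    by exists z => _; split=> //; apply: lt_le_trans yy' yz.
  have [|b bP] := @regular_bound (g @` S).
    move=> le; apply: (K_reg.1.1.1 lam I).
    exact: card_le_trans (card_le_trans le (card_image_le _ _)) Sle.
  exists (Order.max y' b); split=> [|i Si]; first by rewrite lt_max yy'.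
  have [Gg yg] := gP i Si; exists (g i) => //; split=> //.
  by rewrite le_max (ltW (bP _ _)) ?orbT//; exists i.
have [nx nxP] := choice nextP.
pose s n := iter n nx x.
have [b bP] := uncountable_bound (card_image_le s [set: nat]).
have [y yub ymin] := wo_min K_wo (ex_intro [set y | forall n, s n <= y] b
   (fun n => ltW (bP _ (ex_intro2 _ _ n I erefl)))).
exists y; last exact: (yub 0%N).
move=> i Si; apply: (club_sup y (G i)) => //.
  have [g Gg [_ gz]] := (nxP x).2 i Si; exists g; split=> //=.
  by apply: le_lt_trans gz _; apply: lt_le_trans (nxP _).1 (yub 2%N).
split=> [z [_ /ltW]//|z zub]; apply: ymin => n.
have [g Gg [yg gz]] := (nxP (s n)).2 i Si.
apply: le_trans (ltW yg) _; apply: zub; split=> //=.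
by apply: le_lt_trans gz _; apply: lt_le_trans (nxP _).1 (yub n.+2).
Qed.

End Clubs.

(** * Complete ideals and functions with null fibres *)

Section Ideals.
Context {d : Order.disp_t} {K : bOrderType d}.
Implicit Types (a b m x y z mu u v : K) (A B : set K).
Variables (lam delta : K) (J : set (set K)) (k : K -> K).
Hypothesis lam_card : infinite_cardinal (seg lam).
Hypothesis J_ideal : proper_ideal delta J.
Hypothesis J_complete : complete_ideal lam J.
Hypothesis k_lt : forall b, b < delta -> k b < lam.
Hypothesis k_null : forall u, J [set b | b < delta /\ k b = u].

Lemma null_sub A B : A `<=` B -> J B -> J A.
Proof. by have [_ _ + _ _] := J_ideal; apply. Qed.

Lemma null_subI A B C : A `<=` B -> J (B `&` C) -> J (A `&` C).
Proof. by move=> AB; apply: null_sub => b [/AB]. Qed.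

Lemma null_setU A B : J A -> J B -> J (A `|` B).
Proof. by have [_ _ _ + _] := J_ideal; apply. Qed.

Lemma null_set0 : J set0.
Proof. by have [] := J_ideal. Qed.

Lemma null_bigcup (I : Type) (S : set I) (F : I -> set K) :
  card_lt S (seg lam) -> (forall i, S i -> J (F i)) -> J (\bigcup_(i in S) F i).
Proof.
move=> Slt FJ; apply: (@null_sub _ (\bigcup_(A in F @` S) A)).
  by move=> b [i Si Fb]; exists (F i) => //; exists i.
apply: J_complete => [_ [i Si <-]|le]; first exact: FJ.
by apply: Slt; apply: card_le_trans le (card_image_le _ _).
Qed.

Lemma seg_card_lt a : a < lam -> card_lt (seg a) (seg lam).
Proof. exact: lam_card.1. Qed.

Lemma lam_succ a : a < lam -> exists2 a', a < a' & a' < lam.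
Proof. by move=> al; apply: infinite_cardinal_limit lam_card al. Qed.

Lemma null_fiber_le (f : K -> K) A a :
  (forall u, J (A `&` [set b | f (k b) = u])) -> a < lam ->
  J (A `&` [set b | f (k b) <= a]).
Proof.
move=> fib /lam_succ[a' aa' a'l].
apply: (@null_sub _ (\bigcup_(u in seg a') (A `&` [set b | f (k b) = u]))).
  by move=> b [Ab fa]; exists (f (k b)) => //; apply: le_lt_trans fa aa'.
by apply: null_bigcup => //; apply: seg_card_lt.
Qed.

Lemma null_k A u : A `<=` seg delta -> J (A `&` [set b | k b = u]).
Proof. by move=> As; apply: null_sub (k_null u) => b [/As]. Qed.

(** A cofinal set of fewer than lam ordinals a would cover delta by the null sets where [k b <= a],
    against properness. *)
Lemma lam_regular : regular (seg lam).
Proof.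
split=> // A [Asub Acof]; apply: contrapT => nle.
have [_ _ _ _] := J_ideal; apply.
apply: (@null_sub _ (\bigcup_(a in A) (seg delta `&` [set b | id (k b) <= a]))).
  by move=> b bd; have [a Aa ka] := Acof _ (k_lt bd); exists a.
apply: null_bigcup => // a /Asub al; apply: (null_fiber_le (f := id)) => // u.
Qed.

Lemma lam_bound A : A `<=` seg lam -> ~ (seg lam #<= A) ->
  exists2 b, b < lam & forall a, A a -> a < b.
Proof.
move=> Asub nle; apply: contrapT => nex; apply: nle; apply: lam_regular.2; split=> // x xl.
apply: contrapT => nx; apply: nex; exists x => // a Aa; rewrite ltNge.
by apply/negP => xa; apply: nx; exists a.
Qed.

(** One step of the descent: almost everywhere on A, g lies below f. Since g is again a function on
    lam with null fibres, the step can be repeated. *)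
Definition tame (f : K -> K) A := exists g : K -> K,
  [/\ forall x, x < lam -> g x < lam,
      forall u, J (A `&` [set b | g (k b) = u]) &
      J (A `&` [set b | ~ g (k b) < f (k b)])].

Lemma tame_sub f A B : A `<=` B -> tame f B -> tame f A.
Proof.
by move=> AB [g [gl gf glt]]; exists g; split=> // [u|]; apply: (null_subI AB).
Qed.

Lemma tame_split f A (P : set K) :
  tame f (A `&` [set b | P (k b)]) -> tame f (A `&` [set b | ~ P (k b)]) -> tame f A.
Proof.
move=> [g [gl gf glt]] [h [hl hf hlt]].
exists (fun x => if pselect (P x) then g x else h x); split.
- by move=> x xl; case: pselect => Px; [exact: gl|exact: hl].
- move=> u; apply: null_sub (null_setU (gf u) (hf u)) => b [Ab /=].
  by case: pselect => Pb e; [left|right].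
- apply: null_sub (null_setU glt hlt) => b [Ab /=].
  by case: pselect => Pb e; [left|right].
Qed.

(* At a point a outside e, closedness of e bounds e below a, which gives the value
   below a. *)
Lemma regressive_tame f (R : K -> K -> Prop) (e A : set K) :
  A `<=` seg delta -> (forall x, x < lam -> f x < lam) ->
  (forall u, J (A `&` [set b | f (k b) = u])) ->
  (forall u, u < lam -> J (A `&` [set b | R u (f (k b))])) ->
  club (seg lam) e -> (forall a, e a -> exists2 u, u < a & R u a) ->
  tame f A.
Proof.
move=> Asub fl ffib Rnull [[esub ecl] [_ ecof]] eR.
pose P x u := u < f x /\ (R u (f x) \/ forall a, e a -> a < f x -> a <= u).
have gP x : exists u, (u <= f x) /\ (x < lam -> f x != \bot -> P x u).
  have [xl|nx] := pselect (x < lam); last by exists \bot; split=> //; exact: le0x.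
  have [fx0|fx0] := eqVneq (f x) \bot.
    by exists \bot; split=> //; exact: le0x.
  suff [u [uf Pu]] : exists u, P x u by exists u; split=> //; exact: ltW.
  have [ef|nef] := pselect (e (f x)).
    by have [u uf Ru] := eR _ ef; exists u; split=> //; left.
  apply: contrapT => nex; apply: nef; apply: ecl; first exact: fl.
    apply: contrapT => ne; apply: nex; exists \bot; split; first by rewrite lt0x.
    by right=> a ea af; exfalso; apply: ne; exists a.
  split=> [a [_ /ltW]//|u uub]; rewrite leNgt; apply/negP => uf.
  by apply: nex; exists u; split=> //; right => a ea af; apply: uub.
have [g {}gP] := choice gP; exists g.
have f0 := ffib \bot.
have gl x : x < lam -> g x < lam.
  by move=> xl; apply: le_lt_trans (gP x).1 (fl _ xl).
split=> // [u|]; last first.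
  apply: null_sub f0 => b [Ab ng]; split=> //=; apply: contrapT => /eqP fb.
  by apply: ng; have [] := (gP (k b)).2 (k_lt (Asub _ Ab)) fb.
have [ul|nul] := pselect (u < lam); last first.
  apply: null_sub null_set0 => b [Ab /= gu]; apply: nul; rewrite -gu.
  exact/gl/k_lt/Asub.
(* For this a in e, strictly above u, the second disjunct of [P] with value u forces [f (k b) <= a],
   which holds only on a null set. *)
have [u' uu' u'l] := lam_succ ul; have [a ea u'a] := ecof _ u'l.
have al := esub _ ea; have ua := lt_le_trans uu' u'a.
apply: null_sub (null_setU f0 (null_setU (Rnull _ ul) (null_fiber_le ffib al))).
move=> b [Ab /= gu].
have [fb0|fb0] := eqVneq (f (k b)) \bot; first by left.
have [_ []] := (gP (k b)).2 (k_lt (Asub _ Ab)) fb0; rewrite gu => H; right.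
  by left.
right; split=> //=; rewrite leNgt; apply/negP => /(H _ ea).
by rewrite leNgt ua.
Qed.

End Ideals.

(** * Refuting many colorings at once *)

Lemma card_le_surj (d : Order.disp_t) (K : bOrderType d) (theta : K) (Y : set K) :
  seg theta #<= Y -> exists g : K -> K, forall tau, tau < theta -> exists2 t, Y t & g t = tau.
Proof.
move=> /card_leK[f [fY fi]]; exists (fun t => xget \bot [set tau | tau < theta /\ f tau = t]).
move=> tau tt; exists (f tau); first exact: fY.
by apply: xget_unique => // x [xt]; apply: fi.
Qed.

Section Failure.
Context {d : Order.disp_t} {K : bOrderType d}.
Hypothesis K_wo : well_order (<=%O : rel K).
Implicit Types (a b m x y z mu u v tau delta : K) (A D : set K).
Variables (lam theta : K) (E : set K) (J : K -> set (set K)) (k : K -> K -> K).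
(* Q stands for the clubs of kappa, and B delta D for the beta < delta with
   min (C_delta \ (beta + 1)) in D and T. *)
Variables (Q : set (set K)) (B : K -> set K -> set K).
Hypothesis lam_card : infinite_cardinal (seg lam).
Hypothesis theta_gt0 : \bot < theta.
Hypothesis J_ideal : forall delta, E delta -> proper_ideal delta (J delta).
Hypothesis J_complete : forall delta, E delta -> complete_ideal lam (J delta).
Hypothesis k_lt : forall delta, E delta -> forall b, b < delta -> k delta b < lam.
Hypothesis k_null : forall delta, E delta ->
  forall u, J delta [set b | b < delta /\ k delta b = u].
Hypothesis Q_bigcap : forall (X : Type) (S : set X) (G : X -> set K),
  S #<= seg lam -> (forall i, S i -> Q (G i)) -> Q (\bigcap_(i in S) G i).
Hypothesis B_sub : forall delta D, B delta D `<=` seg delta.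
Hypothesis B_mono : forall delta D D', D `<=` D' -> B delta D `<=` B delta D'.
Hypothesis B_guess : forall D, Q D -> exists2 delta, E delta & ~ J delta (B delta D).
(** The negation of the conclusion sought; contradictions are derived from it case by case. *)
Hypothesis fail : forall h : K -> K -> K,
  (forall delta, E delta -> forall x, x < lam -> h delta x < theta) ->
  exists2 D, Q D & forall delta, E delta -> exists2 tau, tau < theta &
    J delta (B delta D `&` [set b | h delta (k delta b) = tau]).

Let sub delta (Ed : E delta) A A' : A `<=` A' -> J delta A' -> J delta A :=
  null_sub (J_ideal Ed) (A := A) (B := A').

Let subI delta (Ed : E delta) A A' C :
  A `<=` A' -> J delta (A' `&` C) -> J delta (A `&` C) :=
  null_subI (J_ideal Ed) (A := A) (B := A') (C := C).

Lemma Q_setT : Q [set: K].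
Proof.
rewrite (_ : [set: K] = \bigcap_(i in set0) (fun _ : K => set0 : set K) i).
  by apply: Q_bigcap => //; exact: card_ge0.
by rewrite bigcap_set0.
Qed.

Lemma finite_le_lam (X : Type) (S : set X) : finite_set S -> S #<= seg lam.
Proof.
move=> fS; apply: card_le_trans (finite_set_countable fS) _.
by apply/infiniteP; have [] := lam_card.
Qed.

Lemma Q_setI D D' : Q D -> Q D' -> Q (D `&` D').
Proof.
move=> QD QD'.
rewrite (_ : D `&` D' = \bigcap_(i in [set: bool]) (if i then D else D')).
  apply: Q_bigcap; last by case.
  exact/finite_le_lam/finite_finset.
apply/seteqP; split=> [x [Dx Dx'] [] //|x H]; split; first exact: (H true).
exact: (H false).
Qed.

Lemma fail_family (X : Type) (S : set X) (h : X -> K -> K -> K) D :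
  S #<= seg lam -> Q D -> exists D', [/\ Q D', D' `<=` D &
    forall i, S i -> forall delta, E delta -> exists2 tau, tau < theta &
      J delta (B delta D' `&` [set b | h i delta (k delta b) = tau])].
Proof.
move=> Sle QD.
(* Colorings of the family may leave theta; such values are reset to [\bot]. A null color of [h']
   below theta is also null for [h]. *)
pose h' i delta x := if h i delta x < theta then h i delta x else \bot.
have h'_lt i delta x : h' i delta x < theta by rewrite /h'; case: ifP.
have [G GP] := choice (fun i => let (D', p, q) := fail (fun delta _ x _ => h'_lt i delta x)
  in ex_intro (fun D' => Q D' /\ _) D' (conj p q)).
exists (D `&` \bigcap_(i in S) G i); split.
- by apply: Q_setI => //; apply: Q_bigcap => // i _; have [] := GP i.
- by move=> x [].
move=> i Si delta Ed; have [_ /(_ _ Ed)[tau taut Jt]] := GP i.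
exists tau => //; apply: sub Jt => // b [Bb /= e]; split=> /=.
  by apply: B_mono Bb => x [_ /(_ i Si)].
by rewrite /h' e taut.
Qed.

Lemma descent (F : set K -> set K) D0 :
  (forall D, Q D -> Q (F D) /\ F D `<=` D) -> Q D0 ->
  exists r : K -> set K, [/\ forall x, x <= lam -> Q (r x),
    forall x y, x < y -> y <= lam -> r y `<=` F (r x) & r lam `<=` D0].
Proof.
move=> FQ QD0.
(* The filler [D0] for y not below x lets every stage be an intersection over all of [seg lam], and
   stage [\bot] is [D0] itself. *)
pose G x r y := if y < x then F (r y) else D0 : set K.
have [|r rE] := @wf_fix _ _ _ (fun x r => \bigcap_(y in seg lam) G x r y) set0 (lt_wf K_wo).
  move=> x g h gh; apply: eq_bigcapr => y _; rewrite /G.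
  by case: ifP => // yx; rewrite gh.
have Qr x : x <= lam -> Q (r x).
  elim/(lt_ind K_wo): x => x IH xl; rewrite rE; apply: Q_bigcap; first exact: card_lexx.
  move=> y _; rewrite /G; case: ifP => // yx.
  by have [] := FQ _ (IH _ yx (ltW (lt_le_trans yx xl))).
have rF x y : x < y -> y <= lam -> r y `<=` F (r x).
  by move=> xy yl z; rewrite [r y]rE => /(_ x (lt_le_trans xy yl)); rewrite /G xy.
exists r; split=> // z.
have l0 : \bot < lam.
  rewrite lt0x; apply/eqP => l0; have [_ /infinite_setN0[z' /=]] := lam_card.
  by rewrite l0 /seg /= ltx0.
move=> /(rF _ _ l0 (lexx _)) /((FQ _ (Qr _ (le0x _))).2); rewrite rE => /(_ \bot l0).
by rewrite /G ltxx.
Qed.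

Definition colors delta (c : K -> K) A : set K :=
  [set tau | ~ J delta (A `&` [set b | c (k delta b) = tau])].

Lemma colors_mono delta c A A' : E delta -> A `<=` A' -> colors delta c A `<=` colors delta c A'.
Proof. by move=> Ed AA' tau nA; apply: contra_not nA; apply: subI. Qed.

Lemma thin (X : Type) (S : set X) (c : K -> X -> K -> K) mu D0 :
  S #<= seg lam -> mu < lam ->
  (forall delta i x, E delta -> S i -> x < lam -> c delta i x < mu) ->
  Q D0 -> exists D, [/\ Q D, D `<=` D0 & forall delta i, E delta -> S i ->
    ~ (seg theta #<= colors delta (c delta i) (B delta D))].
Proof.
move=> Sle mul c_lt QD0.
pose Y delta i D := colors delta (c delta i) (B delta D).
(* While theta many colors are positive, g maps them onto theta, so a color of the composite that
   becomes null costs a positive color of c. *)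
have [g gP] : exists g : K * X * set K -> K -> K, forall delta i D,
    seg theta #<= Y delta i D ->
    forall tau, tau < theta -> exists2 t, Y delta i D t & g (delta, i, D) t = tau.
  have [|g gP] := @choice (K * X * set K) (K -> K) (fun p g => seg theta #<= Y p.1.1 p.1.2 p.2 ->
    forall tau, tau < theta -> exists2 t, Y p.1.1 p.1.2 p.2 t & g t = tau).
    move=> [[delta i] D] /=.
    have [/card_le_surj[g gP]|n] := pselect (seg theta #<= Y delta i D); last by exists id.
    by exists g.
  by exists g => delta i D; apply: (gP (delta, i, D)).
have [|F FP] := @choice _ _ (fun D D' => Q D -> [/\ Q D', D' `<=` D &
    forall i, S i -> forall delta, E delta -> exists2 tau, tau < theta &
      J delta (B delta D' `&` [set b | g (delta, i, D) (c delta i (k delta b)) = tau])]).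
  move=> D; have [QD|nQ] := pselect (Q D); last by exists set0.
  have [D' D'P] := @fail_family X S (fun i delta x => g (delta, i, D) (c delta i x)) D Sle QD.
  by exists D'.
have FQ D : Q D -> Q (F D) /\ F D `<=` D by move=> /FP[].
have [r [rQ rF rD0]] := descent FQ QD0.
exists (r lam); split=> // [|delta i Ed Si le]; first exact: rQ.
(* Positive colors only get lost, so theta many at the end means theta many at every stage. The
   color [t x] is positive at stage x and null at all later ones; hence t injects lam into mu. *)
have [|t tP] := @choice _ _ (fun x t => x < lam ->
    Y delta i (r x) t /\ J delta (B delta (F (r x)) `&` [set b | c delta i (k delta b) = t])).
  move=> x; have [xl|nx] := pselect (x < lam); last by exists \bot.
  have Qx := rQ _ (ltW xl).
  have rx : r lam `<=` r x by apply: subset_trans (rF _ _ xl (lexx _)) (FQ _ Qx).2.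
  have lex : seg theta #<= Y delta i (r x).
    by apply: card_le_trans le (subset_card_le _); apply: colors_mono => //; apply: B_mono.
  have [_ _ /(_ i Si delta Ed)[tau taut Jt]] := FP _ Qx.
  have [t Yt gt] := gP _ _ _ lex _ taut; exists t => _; split=> //.
  by apply: sub Jt => // b [Bb /= ->].
have [c1 _] := lam_card; apply: (c1 _ mul); apply/card_leK; exists t; split=> [x xl|].
  apply: contrapT => nt; have [nJ _] := tP x xl; apply: nJ.
  apply: sub (null_set0 (J_ideal Ed)) => // b [/B_sub bd /= e]; apply: nt.
  by rewrite -e; apply: c_lt => //; apply: k_lt.
have tne x y : x < y -> y < lam -> t x <> t y.
  move=> xy yl e; have [nJ _] := tP y yl; apply: nJ; rewrite -e.
  have [_] := tP x (lt_trans xy yl); apply: subI => //.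
  by apply: B_mono; apply: rF => //; exact: ltW.
move=> x y xl yl e; case: (lt_tri x y) => // lt; exfalso; first exact: tne e.
by apply: tne (esym e).
Qed.

Hypothesis lam_uncountable : ~ countable (seg lam).

(** Iterating from the identity, whose fibres are those of [k delta], gives an infinite descending
    sequence of ordinals at almost every point of a positive set: the exceptions form countably many
    null sets, and lam is uncountable. *)
Lemma no_tame_descent :
  (forall D (f : K -> K -> K), Q D ->
    (forall delta, E delta -> forall x, x < lam -> f delta x < lam) ->
    (forall delta, E delta -> forall u,
       J delta (B delta D `&` [set b | f delta (k delta b) = u])) ->
    exists D', [/\ Q D', D' `<=` D & forall delta, E delta ->
      tame lam (J delta) (k delta) (f delta) (B delta D')]) -> False.
Proof.
move=> step.
pose inv (s : set K * (K -> K -> K)) := [/\ Q s.1,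
  forall delta, E delta -> forall x, x < lam -> s.2 delta x < lam &
  forall delta, E delta -> forall u,
    J delta (B delta s.1 `&` [set b | s.2 delta (k delta b) = u])].
have [|nx nxP] := @choice _ _ (fun s s' => inv s -> [/\ inv s', s'.1 `<=` s.1 &
  forall delta, E delta ->
    J delta (B delta s'.1 `&` [set b | ~ s'.2 delta (k delta b) < s.2 delta (k delta b)])]).
  move=> s; have [[Qs sl sf]|ns] := pselect (inv s); last by exists s.
  have [D' [QD' D's tm]] := step _ _ Qs sl sf.
  have [|f' f'P] := @choice _ _ (fun delta g => E delta ->
     [/\ forall x, x < lam -> g x < lam,
         forall u, J delta (B delta D' `&` [set b | g (k delta b) = u]) &
         J delta (B delta D' `&` [set b | ~ g (k delta b) < s.2 delta (k delta b)])]).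
    move=> delta; have [Ed|nE] := pselect (E delta); last by exists id.
    by have [g gP] := tm delta Ed; exists g.
  exists (D', f') => _; split=> // [|delta /f'P[]//].
  by split=> //= delta /f'P[].
pose s n := iter n nx (([set: K], fun _ x => x) : set K * (K -> K -> K)).
have invs n : inv (s n).
  elim: n => [|n /nxP[]//]; split=> //=; first exact: Q_setT.
  by move=> delta Ed u; apply: sub (k_null Ed u) => // b [/B_sub].
pose D := \bigcap_(n in [set: nat]) (s n).1.
have QD : Q D.
  apply: Q_bigcap => [|n _]; last by have [] := invs n.
  by apply/infiniteP; have [] := lam_card.
have [delta Ed nJ] := B_guess QD; apply: nJ.
pose bad n := B delta (s n.+1).1 `&`
  [set b | ~ (s n.+1).2 delta (k delta b) < (s n).2 delta (k delta b)].
apply: (@sub _ Ed _ (\bigcup_(n in [set: nat]) bad n)); last first.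
  apply: (null_bigcup (J_ideal Ed) (J_complete Ed)) => [|n _].
    by move=> le; apply: lam_uncountable.
  by have [_ _] := nxP _ (invs n); apply.
move=> b Bb; apply: contrapT => nb.
have dec n : (s n.+1).2 delta (k delta b) < (s n).2 delta (k delta b).
  apply: contrapT => nlt; apply: nb; exists n => //; split=> //.
  by apply: B_mono Bb => x /(_ n.+1); apply.
have [m [n _ nm] mle] := wo_min K_wo
  (ex_intro (range (fun n => (s n).2 delta (k delta b))) _ (ex_intro2 _ _ 0%N I erefl)).
have := dec n; rewrite nm ltNge => /negP; apply; apply: mle.
by exists n.+1.
Qed.

Lemma lam_reg : regular (seg lam).
Proof.
have [delta Ed _] := B_guess Q_setT.
exact: (lam_regular lam_card (J_ideal Ed) (J_complete Ed) (k_lt Ed) (k_null Ed)).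
Qed.

Lemma lam_bd A : A `<=` seg lam -> ~ (seg lam #<= A) ->
  exists2 b, b < lam & forall a, A a -> a < b.
Proof.
have [delta Ed _] := B_guess Q_setT.
exact: (lam_bound lam_card (J_ideal Ed) (J_complete Ed) (k_lt Ed) (k_null Ed)).
Qed.

(** * Colorings by splitting levels *)

Section BranchingColors.
Variables (th : K) (a : K -> set K).
Hypothesis th_lt : th < lam.
Hypothesis a_sub : forall i, i < lam -> a i `<=` seg th.
Hypothesis a_inj : forall i j, i < lam -> j < lam -> a i = a j -> i = j.
Hypothesis pow_lt : forall nu, nu < th -> card_lt (pow nu) (seg lam).

Let splits i x tau := [/\ tau < th, a i tau <> a x tau & forall s, s < tau -> a i s = a x s].

Let splits_ex i j : i < lam -> j < lam -> i <> j -> exists tau, splits i j tau.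
Proof.
move=> il jl ij; have [t [tt at_]] : exists t, t < th /\ a i t <> a j t.
  apply: contrapT => nex; apply: ij; apply: a_inj => //.
  have agree t : t < th -> a i t = a j t.
    by move=> tt; apply: contrapT => ne; apply: nex; exists t.
  by apply/seteqP; split=> t at_; [rewrite -agree|rewrite agree] => //;
    [exact: (a_sub il)|exact: (a_sub jl)].
have [m [mt am] mle] := wo_min K_wo (ex_intro [set t | t < th /\ a i t <> a j t] t (conj tt at_)).
exists m; split=> // s sm; apply: contrapT => ne.
by have := mle s (conj (lt_trans sm mt) ne); rewrite leNgt sm.
Qed.

Let c i x := xget \bot (splits i x).

Let cE i x tau : splits i x tau -> c i x = tau.
Proof.
move=> st; apply: xget_unique => // s ss.
case: (lt_tri s tau) => // lt; first by have [_ _ /(_ _ lt)] := st; have [] := ss.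
by have [_ _ /(_ _ lt)] := ss; have [] := st.
Qed.

(** Otherwise, for every i, the set [X i] of levels at which positively many branches leave [a i]
    has order type below [th]. Then A is covered, by nested unions of fewer than lam sets, with null
    nodes and with pieces that each lie in one fibre of [k delta]. *)
Lemma branching_colors delta A : E delta -> A `<=` seg delta -> ~ J delta A ->
  exists2 i, i < lam & seg th #<= colors delta (c i) A.
Proof.
move=> Ed Asub nJ; apply: contrapT => nex; apply: nJ.
have Jbig := null_bigcup (J_ideal Ed) (J_complete Ed).
have J0 := null_set0 (J_ideal Ed).
pose X i : set K := [set tau | ~ J delta (A `&` [set b | splits i (k delta b) tau])].
have X_bd i : i < lam -> exists2 g, g < th & forall x, X i x -> rk (X i) x < g.
  move=> il; apply: (rk_bounded K_wo) => le; apply: nex; exists i => //.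
  apply: card_le_trans le (subset_card_le _) => tau; apply: contra_not.
  by apply: sub => // b [Ab /= st]; split=> //=; exact: cE.
pose node x nu : set K := A `&` [set b | forall s, s <= nu -> a x s = a (k delta b) s].
pose good x := forall nu, nu < th -> ~ J delta (node x nu).
have kl b : A b -> k delta b < lam by move=> Ab; apply: k_lt => //; exact: Asub.
(* A node at level nu is given by a subset s of nu and the truth value P at nu, so there are few
   enough nodes to discard all null ones. *)
have J_bad : J delta (A `&` [set b | ~ good (k delta b)]).
  pose N nu s P := A `&` [set b | [/\ a (k delta b) `&` seg nu = s, a (k delta b) nu = P &
    J delta (node (k delta b) nu)]].
  have JN nu s P : J delta (N nu s P).
    have [[b0 [Ab0 [e0 P0 J1]]]|ne] := pselect (N nu s P !=set0); last first.
      by apply: sub J0 => // b Nb; apply: ne; exists b.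
    apply: sub J1 => // b [Ab [e1 P1 _]]; split=> //= t.
    rewrite le_eqVlt => /orP[/eqP->|tnu]; first by rewrite P0 P1.
    have : (a (k delta b0) `&` seg nu) t = (a (k delta b) `&` seg nu) t by rewrite e0 e1.
    rewrite /setI /seg /= tnu => e.
    by apply/propext; split=> h; [have : a (k delta b0) t /\ true by []|
      have : a (k delta b) t /\ true by []]; [rewrite e|rewrite -e] => -[].
  apply: (@sub _ Ed _ (\bigcup_(nu in seg th) \bigcup_(s in pow nu) (N nu s True `|` N nu s False))).
    move=> b [Ab /existsNP[nu /not_implyP[nut /contrapT Jn]]].
    exists nu => //; exists (a (k delta b) `&` seg nu); first by move=> x [].
    have [h|h] := EM (a (k delta b) nu); [left|right]; split=> //; split=> //.
      exact: propT.
    exact: propF.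
  apply: (Jbig) => [|nu nut]; first by have [+ _] := lam_card; apply.
  by apply: (Jbig) => [|s _]; [exact: pow_lt|apply: (null_setU (J_ideal Ed))].
(* If i and j first differ at nu and all nodes on both branches are positive, then nu
   lies in X i and in X j, which agree below nu; hence i is determined by the order
   type of X i together with the trace of a i on it. *)
pose trace i g := [set xi | xi < g /\ exists nu, [/\ X i nu, rk (X i) nu = xi & a i nu]].
pose piece g t := A `&` [set b | [/\ good (k delta b),
  forall x, X (k delta b) x -> rk (X (k delta b)) x < g & trace (k delta b) g = t]].
have piece_eq g t b b' : piece g t b -> piece g t b' -> k delta b = k delta b'.
  move=> [/kl il [gi ri ti]] [/kl jl [gj rj tj]].
  set i := k delta b in il gi ri ti *; set j := k delta b' in jl gj rj tj *.
  apply: contrapT => ij; have [nu [nut anu agree]] := splits_ex il jl ij.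
  (* Every branch through the positive node of j at nu leaves [a i] exactly at nu. *)
  have Xi : X i nu.
    apply: contra_not (gj _ nut); apply: sub => // y [Ay /= H]; split=> //; split=> //.
      by rewrite -(H nu).
    by move=> s snu; rewrite -(H s (ltW snu)) agree.
  have Xj : X j nu.
    apply: contra_not (gi _ nut); apply: sub => // y [Ay /= H]; split=> //; split=> //.
      by rewrite -(H nu) //; exact: nesym.
    by move=> s snu; rewrite -(H s (ltW snu)) agree.
  have XE : X i `&` seg nu = X j `&` seg nu.
    have se y tau : tau < nu -> splits i y tau = splits j y tau.
      move=> tnu; apply/propext; split=> -[tt at_ ag]; split=> //.
      - by rewrite -agree.
      - by move=> s st; rewrite -agree ?ag//; exact: lt_trans st tnu.
      - by rewrite agree.
      - by move=> s st; rewrite agree ?ag//; exact: lt_trans st tnu.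
    have JE tau : tau < nu -> (A `&` [set b | splits i (k delta b) tau]) =
        (A `&` [set b | splits j (k delta b) tau]).
      by move=> tnu; congr (_ `&` _); apply/funext => y; exact: se.
    by apply/seteqP; split=> tau [Xt tnu]; split=> //; move: Xt; rewrite /X /= JE.
  have rkE : rk (X i) nu = rk (X j) nu by rewrite /rk XE.
  have transfer i' j' : X i' nu -> X j' nu -> rk (X i') nu = rk (X j') nu ->
      rk (X i') nu < g -> trace i' g = trace j' g -> a i' nu -> a j' nu.
    move=> Xi' Xj' e lt te ai; have : trace i' g (rk (X i') nu) by split=> //; exists nu.
    rewrite te => -[_ [nu' [Xn rn an]]]; rewrite e in rn.
    by rewrite -(rk_inj K_wo Xn Xj' rn).
  apply: anu; apply/propext; split; apply: transfer => //.
  - exact: ri.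
  - by rewrite ti tj.
  - exact: rj.
  - by rewrite ti tj.
have J_piece g t : J delta (piece g t).
  have [[b0 pb0]|ne] := pselect (piece g t !=set0); last first.
    by apply: sub J0 => // b pb; apply: ne; exists b.
  apply: sub (k_null Ed (k delta b0)) => // b pb; split; first by apply: Asub; case: pb.
  exact: piece_eq pb pb0.
have {}J_piece : J delta (\bigcup_(g in seg th) \bigcup_(t in pow g) piece g t).
  apply: (Jbig) => [|g gt]; first by have [+ _] := lam_card; apply.
  by apply: (Jbig) => [|t _]; [exact: pow_lt|exact: J_piece].
apply: sub (null_setU (J_ideal Ed) J_bad J_piece) => // b Ab.
have [gb|nb] := EM (good (k delta b)); last by left.
have [g gt gP] := X_bd _ (kl _ Ab).
by right; exists g => //; exists (trace (k delta b) g) => // xi [].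
Qed.

Lemma branching_false : seg theta #<= seg th -> False.
Proof.
(* The default value [\bot] of c has to be a color below [th]. *)
move=> le; have th0 : \bot < th.
  rewrite lt0x; apply/eqP => e; move/card_leK: le => [f [fP _]].
  by have := fP _ theta_gt0; rewrite e /seg /= ltx0.
have [|D [QD _ DP]] := @thin K (seg lam) (fun _ => c) th [set: K] (card_lexx _) th_lt _ Q_setT.
  by move=> _ i x _ _ _; rewrite /c; case: xgetP => // y _ [].
have [delta Ed nJ] := B_guess QD.
have [i il lei] := branching_colors Ed (@B_sub _ _) nJ.
exact: DP Ed il (card_le_trans le lei).
Qed.

End BranchingColors.

Lemma successor_false : is_succ_cardinal theta lam -> False.
Proof.
move=> [_ tl tmin].
have [|e eP] := @choice _ _ (fun x (f : K -> K) => x < lam ->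
    (forall u, u < x -> f u < theta) /\ forall u v, u < x -> v < x -> f u = f v -> u = v).
  move=> x; have [xl|nx] := pselect (x < lam); last by exists id.
  have [mu [muc mux xmu]] := exists_cardinal K_wo x.
  have mut : mu <= theta.
    rewrite leNgt; apply/negP => /(tmin _ muc); rewrite leNgt.
    by rewrite (le_lt_trans mux xl).
  have /card_leK[f [fP fi]] := card_le_trans xmu (card_le_seg mut).
  by exists f.
(* The row of the Ulam matrix at i.1 has more than theta many positive entries u; the
   injection e i.2 turns theta many of them into colors. *)
pose c (i : K * K) x := xget \bot [set z | exists u, [/\ u < x, u < i.2, e x u = i.1 & e i.2 u = z]].
have [||D [QD _ DP]] := @thin (K * K)%type (seg lam `*` seg lam) (fun _ => c) theta [set: K] _ tl _ Q_setT.
- by apply: (card_square K_wo); have [] := lam_card.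
- move=> _ i x _ [_ il] _; rewrite /c; case: xgetP => // y _ [u [_ ui _ <-]].
  by have [+ _] := eP _ il; apply.
have [delta Ed nJ] := B_guess QD.
set A := B delta D in nJ.
have kl b : A b -> k delta b < lam by move=> /B_sub; exact: k_lt.
(* The points with [k delta b <= u] form a null set, and the others fall into theta many classes, so
   one class is positive. *)
have [|T TP] := @choice _ _ (fun u tau => u < lam -> tau < theta /\
    ~ J delta (A `&` [set b | u < k delta b /\ e (k delta b) u = tau])).
  move=> u; have [ul|nu] := pselect (u < lam); last by exists u.
  apply: contrapT => nex; apply: nJ.
  have JT tau : tau < theta -> J delta (A `&` [set b | u < k delta b /\ e (k delta b) u = tau]).
    by move=> tt; apply: contrapT => nj; apply: nex; exists tau.
  have Jle := null_fiber_le lam_card (J_ideal Ed) (J_complete Ed) (k := k delta) (f := id)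
    (fun u => null_k (J_ideal Ed) (k_null Ed) u (@B_sub delta D)) ul.
  apply: sub (null_setU (J_ideal Ed) Jle (null_bigcup (J_ideal Ed) (J_complete Ed) _ JT)) => //.
    move=> b Ab; have [ku|uk] := leP (k delta b) u; first by left.
    by right; exists (e (k delta b) u) => //; have [+ _] := eP _ (kl _ Ab); apply.
  by have [+ _] := lam_card; apply.
(* By regularity of lam, one value of T is taken cofinally often. *)
have [tau taut Hunb] : exists2 tau, tau < theta & forall b, b < lam ->
    exists u, [/\ u < lam, T u = tau & b <= u].
  apply: contrapT => nex.
  have [|g gP] := @choice _ _ (fun tau b => tau < theta ->
      b < lam /\ forall u, u < lam -> T u = tau -> u < b).
    move=> tau; have [tt|nt] := pselect (tau < theta); last by exists tau.
    apply: contrapT => nb; apply: nex; exists tau => // b bl; apply: contrapT => nu.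
    apply: nb; exists b => _; split=> // u ul Tu; rewrite ltNge; apply/negP => bu.
    by apply: nu; exists u.
  have [||b bl bP] := @lam_bd (g @` seg theta).
  - by move=> _ [tau /gP[gl _] <-].
  - move=> le; have [+ _] := lam_card => /(_ _ tl); apply.
    exact: card_le_trans le (card_image_le _ _).
  have [Tb _] := TP b bl; have [_ /(_ b bl erefl)] := gP _ Tb.
  by rewrite ltNge ltW// bP//; exists (T b).
pose H := [set u | u < lam /\ T u = tau].
(* Below z the set H has order type theta; [e z] will inject this part of H into the positive
   colors. *)
have [z [zl Tz] rz] : exists2 z, H z & rk H z = theta.
  apply: contrapT => nex.
  have rH x : H x -> rk H x < theta.
    move=> Hx; case: (lt_tri (rk H x) theta) => // [e'|/(rk_surj K_wo)[y [Hy _ ry]]].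
      by case: nex; exists x.
    by case: nex; exists y.
  have [||b bl bP] := @lam_bd H; first by move=> x [].
    move=> le; have [+ _] := lam_card => /(_ _ tl); apply; apply: card_le_trans le _.
    by apply/card_leK; exists (rk H); split=> [x /rH//|x y Hx Hy]; exact: rk_inj.
  have [u [ul Tu bu]] := Hunb b bl.
  by have := bP u (conj ul Tu); rewrite ltNge bu.
apply: (DP _ (tau, z) Ed); first by split=> //=; apply: lt_trans tl.
apply: (@card_le_trans _ _ _ (H `&` seg z)).
  have [|y yP] := @choice _ _ (fun u y => u < theta -> [/\ H y, y < z & rk H y = u]).
    move=> u; have [ut|nu] := pselect (u < theta); last by exists u.
    by have [|y yP] := @rk_surj _ _ K_wo H z u; [rewrite rz|exists y].
  apply/card_leK; exists y; split=> [u /yP[]//|u v /yP[_ _ ru] /yP[_ _ rv] e'].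
  by rewrite -ru -rv e'.
apply/card_leK; exists (e z); split=> [u [[ul Tu] uz]|u v [_ uz] [_ vz]]; last first.
  by have [_ +] := eP _ zl; apply.
have [_] := TP u ul; rewrite Tu; apply: contra_not; apply: sub => // b [Ab [uk eu]].
split=> //=; apply: xget_unique => [|w [v [vk vz ev <-]]]; first by exists u.
have [_ ei] := eP _ (kl _ Ab).
by rewrite (ei v u vk uk)// ev eu.
Qed.
(** Each coloring [c u], evaluated at f, has a null color [tau u]. When the graph of tau is guessed
    at a, the index u of the guess lies below a and satisfies [c u a = tau u], unless a is at most
    [p u (tau u)]. So this index is a regressive value with null fibres. *)
Lemma diamond_false : theta = lam -> diamond_star lam -> False.
Proof.
move=> thl [AA [AAP AAg]].
have [p [pl pi]] := pairing K_wo lam_card.2.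
have [|phi phiP] := @choice _ _ (fun a (f : set K -> K) => a < lam ->
    (forall A, AA a A -> f A < a) /\ forall A A', AA a A -> AA a A' -> f A = f A' -> A = A').
  move=> a; have [al|na] := pselect (a < lam); last by exists (fun=> \bot).
  by have [_ /card_leK[f fP]] := AAP _ al; exists f.
(* phi a indexes the sets guessed at a by ordinals u < a; the u-th one is decoded, as
   the graph of a function, at the argument u only. *)
pose c u a := xget \bot [set z | z < lam /\ exists A, [/\ AA a A, phi a A = u & A (p u z)]].
apply: no_tame_descent => D f QD fl ffib.
have [D' [QD' D'D fam]] := @fail_family K (seg lam) (fun u delta x => c u (f delta x)) D (card_lexx _) QD.
exists D'; split=> // delta Ed.
have [|tau tauP] := @choice _ _ (fun u t => u < lam -> t < lam /\
    J delta (B delta D' `&` [set b | c u (f delta (k delta b)) = t])).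
  move=> u; have [ul|nu] := pselect (u < lam); last by exists u.
  by have [t tt Jt] := fam u ul delta Ed; exists t; rewrite -thl.
pose Z := [set y | exists2 u, u < lam & y = p u (tau u)].
have [e eclub eAA] : exists2 e, club (seg lam) e & forall a, e a -> AA a (Z `&` seg a).
  by apply: AAg => y [u ul ->]; apply: pl => //; have [] := tauP u ul.
have ffib' u : J delta (B delta D' `&` [set b | f delta (k delta b) = u]).
  by apply: subI (ffib delta Ed u) => //; exact: B_mono.
apply: (regressive_tame lam_card (J_ideal Ed) (J_complete Ed) (k_lt Ed)
    (* For fixed u, the second disjunct holds only on a null set; it covers the a that
       are not closed under the coding. *)
    (R := fun u a => c u a = tau u \/ a <= p u (tau u)) (e := e)) => //.
- exact: fl.
- move=> u ul; have [tl Jt] := tauP u ul.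
  have Jle := null_fiber_le lam_card (J_ideal Ed) (J_complete Ed) ffib' (pl _ _ ul tl).
  by apply: sub (null_setU (J_ideal Ed) Jt Jle) => // b [Bb []]; [left|right].
- move=> a ea; have al : a < lam by have [[es _] _] := eclub; exact: es.
  have [phil phii] := phiP a al; have AAZ := eAA a ea.
  have ua := phil _ AAZ; exists (phi a (Z `&` seg a)) => //.
  set u := phi a _ in ua *; have ul := lt_trans ua al; have [tl _] := tauP u ul.
  have [le|lt] := leP a (p u (tau u)); [by right|left].
  apply: xget_unique => [|z [zl [A [AAA pA Az]]]].
    split=> //; exists (Z `&` seg a); split=> //; split=> //=.
    by exists u.
  have AE := phii _ _ AAA AAZ pA; rewrite AE in Az.
  have [[v vl e1] _] := Az; have [tv _] := tauP v vl.
  by have [-> ->] := pi _ _ _ _ ul zl vl tv e1.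
Qed.

(** * Countably many colors *)

Section Omega.
Hypothesis theta_omega : is_omega theta.

Lemma theta_countable : countable (seg theta).
Proof.
have [_ fin] := theta_omega.
apply/(card_leE 0%N); exists (fun x => #|` fset_set (seg x)|%fset); split=> // x y xt yt.
have mono u v : u < v -> v < theta -> (#|` fset_set (seg u)| < #|` fset_set (seg v)|)%fset%N.
  move=> uv vt; have fv := fin v vt; have fu := fin u (lt_trans uv vt).
  apply: fproper_ltn_card; rewrite fproperE; apply/andP; split.
    apply/fsubsetP => w; rewrite !in_fset_set// => /set_mem wu; apply/mem_set.
    exact: lt_trans wu uv.
  apply/fsubsetPn; exists u; rewrite in_fset_set//; first exact/mem_set.
  by apply/negP => /set_mem; rewrite /seg /= ltxx.
by case: (lt_tri x y) => // lt e; exfalso;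
  [have := mono _ _ lt yt|have := mono _ _ lt xt]; rewrite e ltnn.
Qed.

Lemma theta_lt_lam : theta < lam.
Proof.
rewrite ltNge; apply/negP => /card_le_seg le; apply: lam_uncountable.
exact: card_le_trans le theta_countable.
Qed.

Lemma not_inaccessible_false : ~ strongly_inaccessible lam -> False.
Proof.
move=> ninacc.
have [mu mul lmu] : exists2 mu, mu < lam & seg lam #<= pow mu.
  apply: contrapT => nex; apply: ninacc; split; first by split=> //; exact: lam_reg.
  by move=> mu mul le; apply: nex; exists mu.
have [th lth thmin] := wo_min K_wo (ex_intro [set mu | seg lam #<= pow mu] mu lmu).
have /(card_leE set0)[a [ath ai]] := lth.
apply: (@branching_false th a) => //.
- exact: le_lt_trans (thmin _ lmu) mul.
- by move=> nu nut /thmin; rewrite leNgt nut.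
(* Were [th] below omega, all subsets of [seg th] would be finite, hence only countably many. *)
- apply: card_le_seg; rewrite leNgt; apply/negP => tt.
  have [_ /(_ _ tt) fin] := theta_omega; apply: lam_uncountable; apply: card_le_trans lth _.
  apply: (@card_le_trans _ _ _ [set A | A `<=` seg th /\ finite_set A]).
    by apply: subset_card_le => A As; split=> //; exact: sub_finite_set fin.
  exact: countable_finite_subset (finite_set_countable fin).
Qed.

(** A sequence is coded by a bound b below lam and its code among the sequences below b; these
    inject, through their graphs, into the power set of an infinite mu below lam. *)
Lemma sequences_le_lam : (forall mu, mu < lam -> card_lt (pow mu) (seg lam)) ->
  [set s : nat -> K | forall n, s n < lam] #<= seg lam.
Proof.
move=> pow_lt.
have /infiniteP/card_leK[io [iot ioi]] := theta_omega.1.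
have [p [pl pi]] := pairing K_wo lam_card.2.
have [|bd bdP] := @choice _ _ (fun (s : nat -> K) b => (forall n, s n < lam) ->
    b < lam /\ forall n, s n < b).
  move=> s; have [sl|ns] := pselect (forall n, s n < lam); last by exists \bot.
  have [||b bl bP] := @lam_bd (range s); first by move=> _ [n _ <-]; exact: sl.
    by move=> le; apply: lam_uncountable; apply: card_le_trans le (card_image_le _ _).
  by exists b => _; split=> // n; apply: bP; exists n.
have [|code codeP] := @choice _ _ (fun b (f : (nat -> K) -> K) => b < lam ->
    (forall s, (forall n, s n < b) -> f s < lam) /\
    forall s t, (forall n, s n < b) -> (forall n, t n < b) -> f s = f t -> s = t).
  move=> b; have [bl|nb] := pselect (b < lam); last by exists (fun=> \bot).
  pose mu := Order.max b theta.
  have mul : mu < lam by rewrite gt_max bl theta_lt_lam.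
  have imu : infinite_set (seg mu).
    move=> fmu; apply: theta_omega.1; apply: sub_finite_set fmu => x /= xt.
    by rewrite /seg /= lt_max xt orbT.
  have [q [ql qi]] := pairing K_wo imu.
  have le : [set s : nat -> K | forall n, s n < b] #<= pow mu.
    have smu s n : (forall n, s n < b) -> s n < mu by move=> sb; rewrite lt_max sb.
    have imu' n : io n < mu by rewrite lt_max [_ < theta](iot n I) orbT.
    apply/(card_leE set0); exists (fun s => [set y | exists n, y = q (s n) (io n)]); split.
      by move=> s sb _ [n ->]; apply: ql => //; exact: smu.
    move=> s t sb tb e; apply/funext => n.
    have : [set y | exists n, y = q (t n) (io n)] (q (s n) (io n)) by rewrite -e; exists n.
    move=> [m /qi[]//]; [exact: smu|exact: smu|].
    by move=> -> /ioi->.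
  have [|le'] := card_total K_wo set0 (seg lam) (pow mu).
    by move=> /(pow_lt _ mul).
  have /card_leK[f fP] := card_le_trans le le'.
  by exists f.
apply/card_leK; exists (fun s => p (bd s) (code (bd s) s)); split=> [s sl|s t sl tl].
  by have [bl sb] := bdP s sl; apply: pl => //; have [+ _] := codeP _ bl; apply.
have [bl sb] := bdP s sl; have [bl' tb] := bdP t tl.
have [cl ci] := codeP _ bl; have [cl' _] := codeP _ bl'.
move=> /pi[||||e1]; [exact: bl|exact: cl|exact: bl'|exact: cl'|].
rewrite -e1 => /ci; apply=> //.
by rewrite e1.
Qed.

(** If f is not tame, conditions of the form that u belongs, or does not belong, to [A (fk b)] cut
    off positive parts one after another, the rest never being tame. The sequence s of these
    conditions then has omega many positive colors, which thinning had excluded. *)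
Lemma not_ineffable_false : ~ ineffable lam -> False.
Proof.
move=> nineff.
have [|inacc] := EM (strongly_inaccessible lam); last exact: not_inaccessible_false.
move=> [lamru pow_lt].
have [A [Asub Acoh]] : exists A : K -> set K, (forall a, a < lam -> A a `<=` seg a) /\
    forall Z, Z `<=` seg lam -> exists2 e, club (seg lam) e &
      forall a, e a -> a < lam /\ Z `&` seg a <> A a.
  apply: contrapT => nex; apply: nineff; split=> // A Asub; apply: contrapT => nB.
  apply: nex; exists A; split=> // Z Zl; apply: contrapT => ne; apply: nB; exists Z => //.
  split=> [a []//|e eclub]; apply: contrapT => nSe; apply: ne; exists e => // a ea.
  have al : a < lam by have [[es _] _] := eclub; exact: es.
  by split=> // Za; apply: nSe; exists a.
have /infiniteP/card_leK[io [iot ioi]] := theta_omega.1.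
have l0 : \bot < lam by apply: lt_trans theta_gt0 theta_lt_lam.
(* As the second entry of a condition, [\bot] stands for membership and any other value, such as
   [one], for its negation. *)
have [one one0 onel] := lam_succ lam_card l0.
apply: no_tame_descent => D f QD fl ffib.
(* The odd entries of s choose between membership and its negation. *)
pose hit (s : nat -> K) y n := A y (s n.*2) <-> s n.*2.+1 = \bot.
pose c delta s x := xget \bot [set y | exists n, [/\ y = io n, hit s (f delta x) n &
  forall j, (j < n)%N -> ~ hit s (f delta x) j]].
have [|D' [QD' D'D D'P]] := @thin (nat -> K) _ c theta D (sequences_le_lam pow_lt) theta_lt_lam _ QD.
  by move=> delta s x _ _ _; rewrite /c; case: xgetP => // y _ [n [-> _ _]]; exact: iot.
exists D'; split=> // delta Ed; apply: contrapT => ntame.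
set A0 := B delta D' in ntame.
pose fk b := f delta (k delta b).
pose half (A1 : set K) (i : K * K) (P : Prop) := A1 `&` [set b | (A (fk b) i.1 <-> i.2 = \bot) <-> P].
have pickP A1 : exists i : K * K, A1 `<=` A0 -> ~ tame lam (J delta) (k delta) (f delta) A1 ->
    [/\ i.1 < lam, i.2 < lam, ~ J delta (A1 `&` [set b | A (fk b) i.1 <-> i.2 = \bot]) &
      ~ tame lam (J delta) (k delta) (f delta) (A1 `&` [set b | ~ (A (fk b) i.1 <-> i.2 = \bot)])].
  apply: contrapT => nex.
  have [A1s ntA1] : A1 `<=` A0 /\ ~ tame lam (J delta) (k delta) (f delta) A1.
    by split; [apply: contrapT => h|move=> h]; apply: nex; exists (\bot, \bot).
  have A1d : A1 `<=` seg delta by move=> b /A1s /B_sub.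
  have fib u : J delta (A1 `&` [set b | fk b = u]).
    by apply: subI (ffib delta Ed u) => // b /A1s; exact: B_mono.
  have no i : i.1 < lam -> i.2 < lam -> J delta (A1 `&` [set b | A (fk b) i.1 <-> i.2 = \bot]) \/
      tame lam (J delta) (k delta) (f delta) (A1 `&` [set b | ~ (A (fk b) i.1 <-> i.2 = \bot)]).
    move=> i1 i2; apply: contrapT => /not_orP[h1 h2]; apply: nex; exists i => _ _; split=> //.
  (* Were both halves positive, each would be tame, being the rest left by the other, and so would
     their union [A1]. *)
  have atom u : u < lam -> J delta (A1 `&` [set b | A (fk b) u]) \/ J delta (A1 `&` [set b | ~ A (fk b) u]).
    move=> ul; apply: contrapT => /not_orP[j1 j0]; apply: ntA1.
    apply: (tame_split (J_ideal Ed) (P := [set x | A (f delta x) u])).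
      have [Jh|th] := no (u, one) ul onel.
        exfalso; apply: j0; apply: sub Jh => // b [Ab /= nA]; split=> //=.
        by split=> // e; rewrite e ltxx in one0.
      apply: tame_sub th; first exact: J_ideal.
      move=> b [Ab /= Au]; split=> //= -[/(_ Au) e _].
      by rewrite e ltxx in one0.
    have [Jh|th] := no (u, \bot) ul l0.
      by exfalso; apply: j1; apply: sub Jh => // b [Ab /= nA]; split.
    apply: tame_sub th; first exact: J_ideal.
    by move=> b [Ab /= nAu]; split=> //= -[_ /(_ erefl)].
  (* At each single u, almost all [A (fk b)] agree with Z; but at every a in e, [A a] differs from Z
     at some u below a. That u is the regressive value. *)
  pose Z := [set u | u < lam /\ J delta (A1 `&` [set b | ~ A (fk b) u])].
  have [e eclub eP] := Acoh Z (fun u => @proj1 _ _).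
  apply: ntA1; apply: (regressive_tame lam_card (J_ideal Ed) (J_complete Ed) (k_lt Ed)
    (R := fun u a => ~ (A a u <-> Z u)) (e := e)) => //; first exact: fl.
    move=> u ul; have [Zu|nZ] := EM (Z u).
      by apply: sub Zu.2 => // b [Ab /= nAZ]; split=> //= Au; apply: nAZ.
    have [JA|JN] := atom u ul; last by case: nZ.
    by apply: sub JA => // b [Ab /= nAZ]; split=> //=; apply: contrapT => nA; apply: nAZ.
  move=> a /eP[al Za]; apply: contrapT => nu; apply: Za.
  have agree u : u < a -> A a u <-> Z u.
    by move=> ua; apply: contrapT => nAZ; apply: nu; exists u.
  apply/seteqP; split=> u; first by move=> [Zu ua]; apply/agree.
  by move=> Au; have ua := Asub _ al _ Au; split=> //; apply/agree.
have [pick {}pickP] := choice pickP.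
(* Stage n loses the part picked there; on that part the first hit of s is n. *)
pose As n := iter n (fun A1 => A1 `&` [set b | ~ (A (fk b) (pick A1).1 <-> (pick A1).2 = \bot)]) A0.
have AsP n : As n `<=` A0 /\ ~ tame lam (J delta) (k delta) (f delta) (As n).
  elim: n => [|n [IH1 IH2]]; first by split.
  have [_ _ _ nt] := pickP _ IH1 IH2; split=> // b [/IH1].
  by [].
pose s (m : nat) := if odd m then (pick (As m./2)).2 else (pick (As m./2)).1.
have s0 n : s n.*2 = (pick (As n)).1 by rewrite /s odd_double doubleK.
have s1 n : s n.*2.+1 = (pick (As n)).2 by rewrite /s /= odd_double uphalf_double.
have AsE n b : As n b -> forall j, (j < n)%N -> ~ hit s (fk b) j.
  elim: n => // n IH [Ab nh] j; rewrite ltnS leq_eqVlt => /orP[/eqP->|]; last exact: IH.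
  by rewrite /hit s0 s1.
apply: (D'P delta s Ed).
  move=> n; rewrite /s; have [a1 a2] := AsP n./2; have [? ? _ _] := pickP _ a1 a2.
  by case: ifP.
apply: card_le_trans theta_countable _.
apply/card_leK; exists io; split=> [n _|]; last exact: ioi.
have [a1 a2] := AsP n; have [_ _ nJ _] := pickP _ a1 a2; apply: contra_not nJ.
apply: sub => // b [Ab /= hb]; split=> /=; first exact: a1.
apply: xget_unique => [|y [m [-> hm lm]]].
  by exists n; split=> //; [rewrite /hit s0 s1|exact: AsE].
congr io; have hn : hit s (fk b) n by rewrite /hit s0 s1.
case: (ltngtP m n) => // lt; first by case: (AsE _ _ Ab _ lt).
by case: (lm _ lt).
Qed.

End Omega.
End Failure.

(** * Failure of diamond-star at omega *)

(** Compares the exponents in the count of pairs below 2^(j+2) and of patterns on a block of length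
    2^j; j = 3 would fail. *)
Lemma double_lt_expn (j : nat) : (4 <= j)%N -> (j.+2.*2 < 2 ^ j)%N.
Proof.
elim: j => // j IH; rewrite leq_eqVlt => /orP[/eqP<- //|/[dup] j4 /IH lt].
have le2 : (2 <= 2 ^ j)%N by rewrite (@leq_pexp2l 2 1)//; move: j4; case: (j).
by rewrite expnS mul2n -[X in (_ < X)%N]addnn doubleS; apply: leq_trans (leq_add lt le2); rewrite addn2.
Qed.

(* The levels n in [2^(j+1), 2^(j+2)) carry at most n sets each, so they leave fewer than
   2^(2j+4) < 2^(2^j) patterns on the block [2^j, 2^(j+1)). *)
Lemma block_pattern (bit : nat -> nat -> nat -> bool) (j : nat) : (4 <= j)%N ->
  exists p : nat -> bool, forall n i, (n < 2 ^ j.+2)%N -> (i < 2 ^ j.+2)%N ->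
    exists2 x, (x < 2 ^ j)%N & p x != bit n i (2 ^ j + x)%N.
Proof.
move=> j4; pose N := (2 ^ j.+2)%N.
pose F (u : 'I_N * 'I_N) : {ffun 'I_(2 ^ j) -> bool} := 
    [ffun x : 'I_(2 ^ j) => bit u.1 u.2 (2 ^ j + x)%N].
have [p pF] : exists p, p \notin codom F.
  apply/existsP; apply: contraT; rewrite negb_exists => /forallP all.
  have : (#|{ffun 'I_(2 ^ j) -> bool}| <= #|codom F|)%N.
    by apply: subset_leq_card; apply/fintype.subsetP => p _; have := all p; rewrite negbK.
  move=> /leq_trans/(_ (leq_image_card _ _)).
  rewrite card_ffun card_bool card_ord card_prod !card_ord -expnD leq_exp2l//.
  by rewrite addnn leqNgt double_lt_expn.
exists (fun x => if insub x is Some y then p y else false) => n i nN iN.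
have [x px] : exists x : 'I_(2 ^ j), p x != bit n i (2 ^ j + x)%N.
  apply/existsP; apply: contraT; rewrite negb_exists => /forallP all.
  case/negP: pF; apply/codomP; exists (Ordinal nN, Ordinal iN).
  by apply/ffunP => x; rewrite ffunE; apply/eqP; have := all x; rewrite negbK.
by exists x => //; rewrite valK.
Qed.

Lemma anti_guessing (bit : nat -> nat -> nat -> bool) : exists z : nat -> bool,
  forall n i, (32 <= n)%N -> (i < n)%N -> exists2 m, (m < n)%N & z m != bit n i m.
Proof.
have [|p pP] := @choice _ _ (fun j (p : nat -> bool) => (4 <= j)%N ->
    forall n i, (n < 2 ^ j.+2)%N -> (i < 2 ^ j.+2)%N ->
    exists2 x, (x < 2 ^ j)%N & p x != bit n i (2 ^ j + x)%N).
  move=> j; have [j4|_] := leqP 4 j; last by exists xpredT.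
  by have [p pP] := block_pattern bit j4; exists p.
(* On the block [2^j, 2^(j+1)) z follows the j-th pattern. For n in [2^(j+1), 2^(j+2)) this block
   lies below n, and n at least 32 gives j at least 4. *)
exists (fun m => p (trunc_log 2 m) (m - 2 ^ trunc_log 2 m)%N) => n i n32 ni.
have n0 : (0 < n)%N by apply: leq_trans n32.
have /andP[le lt] := trunc_log_bounds (isT : (1 < 2)%N) n0.
have l5 : (5 <= trunc_log 2 n)%N by exact: (@trunc_log_max 2 n 5 isT n32).
case: (trunc_log 2 n) l5 le lt => // j j4 le lt.
have [x xj px] := pP j j4 n i lt (ltn_trans ni lt).
exists (2 ^ j + x)%N.
  by apply: leq_trans le; rewrite expnS mul2n -addnn ltn_add2l.
suff -> : trunc_log 2 (2 ^ j + x) = j by rewrite addKn.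
by apply: trunc_log_eq => //; rewrite leq_addr expnS mul2n -addnn ltn_add2l.
Qed.

Section DiamondStar.
Context {d : Order.disp_t} {K : bOrderType d}.
Hypothesis K_wo : well_order (<=%O : rel K).
Implicit Types (a b x y mu nu lam theta delta : K) (A D : set K).

(** A countable lam would be omega, enumerated by [nu], with at most n guesses at [nu n]. A set Z
    that avoids all guesses from 32 on leaves no unbounded D. *)
Lemma diamond_star_uncountable lam :
  infinite_cardinal (seg lam) -> diamond_star lam -> ~ countable (seg lam).
Proof.
move=> lam_card [AA [AAP AAg]] lam_cnt.
have fin x : x < lam -> finite_set (seg x).
  move=> xl; apply: contrapT => /infiniteP le; apply: (lam_card.1 _ xl).
  exact: card_le_trans lam_cnt le.
have l0 : \bot < lam.
  rewrite lt0x; apply/eqP => l0; have [_ /infinite_setN0[z' /=]] := lam_card.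
  by rewrite l0 /seg /= ltx0.
have [|nx nxP] := @choice _ _ (fun x y => x < lam -> [/\ x < y, y < lam &
    forall z, x < z -> y <= z]).
  move=> x; have [xl|nx] := pselect (x < lam); last by exists x.
  have [x' xx' x'l] := infinite_cardinal_limit lam_card xl.
  have [m xm mle] := wo_min K_wo (ex_intro [set z | x < z] x' xx').
  by exists m => _; split=> //; apply: le_lt_trans (mle _ xx') x'l.
pose nu n := iter n nx \bot.
have nul n : nu n < lam by elim: n => // n IH; have [] := nxP _ IH.
have nuS n : nu n < nu n.+1 by have [] := nxP _ (nul n).
have nu_lt : {homo nu : m n / (m < n)%N >-> m < n}.
  by apply: homo_ltn => // x y z; exact: lt_trans.
have nu_inj : injective nu.
  by move=> m n e; case: (ltngtP m n) => // /nu_lt; rewrite e ltxx.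
have nu_surj x : x < lam -> exists n, x = nu n.
  move=> xl; apply: contrapT => nex.
  have nux n : nu n < x.
    have ne k : nu k != x by apply/eqP => e; apply: nex; exists k.
    elim: n => [|n IH]; rewrite lt_neqAle ne /=; first exact: le0x.
    by have [_ _] := nxP _ (nul n); apply.
  have : infinite_set (seg x).
    by apply/infiniteP/card_leK; exists nu; split=> [u _|u v _ _]; [exact: nux|exact: nu_inj].
  by apply; exact: fin.
have [|phi phiP] := @choice _ _ (fun n (f : set K -> K) =>
    (forall A, AA (nu n) A -> f A < nu n) /\
    forall A A', AA (nu n) A -> AA (nu n) A' -> f A = f A' -> A = A').
  by move=> n; have [_ /card_leK[f fP]] := AAP _ (nul n); exists f.
pose E n i := xget set0 [set A | AA (nu n) A /\ phi n A = nu i].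
have EP n A : AA (nu n) A -> exists2 i, (i < n)%N & E n i = A.
  move=> AAA; have [pl pi] := phiP n; have pA := pl _ AAA.
  have [i ei] := nu_surj _ (lt_trans pA (nul n)).
  exists i; last by apply: xget_unique => // A' [AAA' e]; apply: pi => //; rewrite e.
  rewrite ltnNge; apply/negP => ni; have := pA; rewrite ei ltNge => /negP; apply.
  by move: ni; rewrite leq_eqVlt => /orP[/eqP->|/nu_lt/ltW].
have [z zP] := anti_guessing (fun n i m => `[< E n i (nu m) >]).
pose Z := [set x | exists2 m, x = nu m & z m].
have [D [[Dsub _] [_ Dcof]] DAA] : exists2 D, club (seg lam) D & forall a, D a -> AA a (Z `&` seg a).
  by apply: AAg => x [m -> _]; exact: nul.
have [a Da a32] := Dcof _ (nul 32); have [n an] := nu_surj _ (Dsub _ Da).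
have n32 : (32 <= n)%N.
  by rewrite leqNgt; apply/negP => /nu_lt; rewrite -an ltNge a32.
have := DAA _ Da; rewrite an => /EP[i ni EZ].
have [m mn] := zP n i n32 ni; rewrite EZ => /negP; apply; apply/eqP.
apply/idP/asboolP => [zm|[[m' /nu_inj -> //] _]].
by split; [exists m|exact: nu_lt].
Qed.

Lemma pow_card_le x y : seg x #<= seg y -> pow x #<= pow y.
Proof.
move=> /card_leK[f [fP fi]]; apply/(card_leE set0); exists (fun A => f @` A); split.
  by move=> A As _ [u /As ux <-]; exact: fP.
have sub A A' : A `<=` seg x -> A' `<=` seg x -> f @` A = f @` A' -> A `<=` A'.
  move=> As As' e u Au; have [v Av e'] : (f @` A') (f u) by rewrite -e; exists u.
  by rewrite -(fi v u (As' _ Av) (As _ Au) e').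
by move=> A A' As As' e; apply/seteqP; split; apply: sub.
Qed.

End DiamondStar.

(** * The partition theorem *)

Unset Implicit Arguments.
Set Strict Implicit.
Set Printing Implicit Defensive.

Theorem theoremD (d : Order.disp_t) (K : bOrderType d)
  (K_wo : well_order (<=%O : rel K))
  (K_reg : regular_uncountable [set: K])
  (lam : K) (lam_card : infinite_cardinal (seg lam))
  (theta : K) (theta_card : cardinal (seg theta))
  (T : set K) (T_stat : stationary [set: K] T) (T_lim : T `<=` limit)
  (J : K -> set (set K))
  (J_ideal : forall delta, Ecf lam delta ->
     [/\ proper_ideal delta (J delta),
         complete_ideal lam (J delta) &
         Jbd delta `<=` J delta])
  (C : K -> set K) (C_seq : bounded_C_sequence lam (Ecf lam) C)
  (C_guess : forall D : set K, club [set: K] D ->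
     exists2 delta, Ecf lam delta &
       positive delta (J delta)
         [set beta | beta < delta /\
            (D `&` T) (omin (C delta `\` [set x | x <= beta]))])
  (alternatives :
     [\/ [/\ theta = lam & diamond_star lam],
         [/\ ~ countable (seg lam),
             ~ strongly_inaccessible lam,
             seg lam #<= pow theta &
             forall mu : K, cardinal (seg mu) ->
               seg lam #<= pow mu -> theta <= mu],
         is_succ_cardinal theta lam |
         [/\ is_omega theta, ~ countable (seg lam) & ~ ineffable lam]]) :
  exists h : K -> K -> K,
    (forall delta, Ecf lam delta ->
       forall xi, xi < lam -> h delta xi < theta) /\
    forall D : set K, club [set: K] D ->
      exists2 delta, Ecf lam delta &
        forall tau, tau < theta ->
          positive delta (J delta)
            [set beta | [/\ beta < delta,
                            h delta (otp (C delta `&` seg beta)) = tau &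
                            (D `&` T)
                              (omin (C delta `\` [set x | x <= beta]))]].
Proof.
apply: contrapT => nex.
have Jp delta : Ecf lam delta -> proper_ideal delta (J delta) by move=> /J_ideal[].
have Jc delta : Ecf lam delta -> complete_ideal lam (J delta) by move=> /J_ideal[].
have C_sub delta : Ecf lam delta -> C delta `<=` seg delta.
  by move=> Ed; have [/(_ _ Ed)[[]]] := C_seq.
have C_cof delta b : Ecf lam delta -> b < delta -> exists2 c, C delta c & b < c.
  move=> Ed bd; have [/(_ _ Ed)[_ [_ lub]] _] := C_seq.
  apply: contrapT => nc; suff : delta <= b by rewrite leNgt bd.
  apply: lub => c Cc; rewrite leNgt; apply/negP => bc; apply: nc.
  by exists c.
pose k delta := rk (C delta).
have k_lt delta : Ecf lam delta -> forall b, b < delta -> k delta b < lam.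
  move=> Ed b bd; have [_ /(_ _ Ed)] := C_seq.
  have <- : C delta `&` seg delta = C delta by apply/setIidPl; exact: C_sub.
  apply: lt_le_trans; have [c Cc bc] := C_cof _ _ Ed bd.
  apply: le_lt_trans (rk_le K_wo _ (ltW bc)) _.
  exact: rk_lt (C_sub _ Ed _ Cc).
have k_null delta : Ecf lam delta -> forall u, J delta [set b | b < delta /\ k delta b = u].
  move=> Ed u; have [[b0 [b0d kb0]]|ne] := pselect ([set b | b < delta /\ k delta b = u] !=set0).
    have [_ _ Jb] := J_ideal _ Ed.
    (* The rank at c may still equal that at b0; from c' on it is larger, so c' bounds the fibre. *)
    have [c Cc bc] := C_cof _ _ Ed b0d; have [c' Cc' cc'] := C_cof _ _ Ed (C_sub _ Ed _ Cc).
    apply: Jb; split=> [b []//|]; exists c'; first exact: C_sub.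
    move=> b [bd kb]; rewrite /seg /= ltNge; apply/negP => c'b.
    have := rk_lt K_wo Cc (lt_le_trans cc' c'b).
    have := rk_le K_wo (C delta) (ltW bc).
    by rewrite -[rk _ b0]/(k delta b0) -[rk _ b]/(k delta b) kb kb0 leNgt => /negbTE->.
  apply: (null_sub (Jp _ Ed) _ (null_set0 (Jp _ Ed))) => b bP.
  by apply: ne; exists b.
pose B delta D := [set beta | beta < delta /\ (D `&` T) (omin (C delta `\` [set x | x <= beta]))].
have B_sub delta D : B delta D `<=` seg delta by move=> b [].
have B_mono delta D D' : D `<=` D' -> B delta D `<=` B delta D'.
  by move=> DD' b [bd [Db Tb]]; split=> //; split=> //; exact: DD'.
have B_guess D : club [set: K] D -> exists2 delta, Ecf lam delta & ~ J delta (B delta D).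
  by move=> /C_guess[delta Ed [_ nJ]]; exists delta.
have Q_bigcap (X : Type) (S : set X) (G : X -> set K) : S #<= seg lam ->
    (forall i, S i -> club [set: K] (G i)) -> club [set: K] (\bigcap_(i in S) G i).
  exact: club_bigcap.
have fail (h : K -> K -> K) :
    (forall delta, Ecf lam delta -> forall x, x < lam -> h delta x < theta) ->
    exists2 D, club [set: K] D & forall delta, Ecf lam delta -> exists2 tau, tau < theta &
      J delta (B delta D `&` [set b | h delta (k delta b) = tau]).
  move=> hl; apply: contrapT => nD; apply: nex; exists h; split=> // D Dclub.
  apply: contrapT => nd; apply: nD; exists D => // delta Ed.
  apply: contrapT => nt; apply: nd; exists delta => // tau taut; split=> [b []//|Jt].
  apply: nt; exists tau => //; apply: (null_sub (Jp _ Ed) _ Jt).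
  by move=> b [[bd Db] hb].
have l0 : \bot < lam.
  rewrite lt0x; apply/eqP => l0; have [_ /infinite_setN0[z' /=]] := lam_card.
  by rewrite l0 /seg /= ltx0.
(* Each alternative excludes 0: it is below lam, has a finite power set, has successor cardinal 1,
   and is finite, respectively. *)
have theta_gt0 : \bot < theta.
  rewrite lt0x; apply/eqP => t0; rewrite t0 in alternatives.
  have seg0 : seg (\bot : K) = set0 by apply/seteqP; split=> x //=; rewrite /seg /= ltx0.
  case: alternatives => [[e _]|[unc _ le _]|[_ _ tmin]|[[inf _] _ _]].
  - by rewrite -e ltxx in l0.
  - apply: unc; apply: card_le_trans le _; apply: finite_set_countable.
    rewrite /pow seg0; apply: (sub_finite_set _ (finite_set1 (set0 : set K))) => A A0.
    by apply/seteqP; split.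
  - have [one one0 onel] := infinite_cardinal_limit lam_card l0.
    have [mu [muc mule le]] := exists_cardinal K_wo one.
    have mu0 : \bot < mu.
      rewrite lt0x; apply/eqP => e; move/card_leK: le => [f [/(_ \bot one0)]].
      by rewrite e seg0.
    by have := tmin _ muc mu0; rewrite leNgt (le_lt_trans mule onel).
  - by apply: inf; rewrite seg0.
case: alternatives => [[tl dia]|[unc ninacc le tmin]|succ|[omega unc nineff]].
- apply: (diamond_false K_wo lam_card theta_gt0 Jp Jc k_lt k_null Q_bigcap B_sub B_mono B_guess fail) => //.
  exact: diamond_star_uncountable.
(* As lam is regular and uncountable, only the strong limit property can fail; this puts theta below
   lam. *)
- have [mu mul lmu] : exists2 mu, mu < lam & seg lam #<= pow mu.
    apply: contrapT => nmu; apply: ninacc; split.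
      split=> //; exact: (lam_reg lam_card Jp Jc k_lt k_null Q_bigcap B_guess).
    by move=> mu mul lmu; apply: nmu; exists mu.
  (* Minimality of theta passes from cardinals to all ordinals. *)
  have tmin' nu : seg lam #<= pow nu -> theta <= nu.
    move=> lnu; have [nu' [nuc nule le']] := exists_cardinal K_wo nu.
    apply: le_trans nule; apply: tmin => //; exact: card_le_trans lnu (pow_card_le le').
  have /(card_leE set0)[a [ath ai]] := le.
  apply: (branching_false K_wo lam_card theta_gt0 Jp Jc k_lt k_null Q_bigcap B_sub B_mono B_guess fail
    (th := theta) (a := a)) => //.
  + exact: le_lt_trans (tmin' _ lmu) mul.
  + by move=> nu nut /tmin'; rewrite leNgt nut.
- exact: (successor_false K_wo lam_card theta_gt0 Jp Jc k_lt k_null Q_bigcap B_sub B_mono B_guess fail).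
- exact: (not_ineffable_false K_wo lam_card theta_gt0 Jp Jc k_lt k_null Q_bigcap B_sub B_mono B_guess fail).
Qed.
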